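(* Let $(M^n,J,g)$ be a balanced BTP Hermitian manifold of complex dimension $n\ge2$ with $H^c\equiv 0$. If the torsion Lie algebra $\mathfrak g_p=(T^{1,0}_pM,T_p)$ is nilpotent at one point $p\in M$, then $T\equiv0$ and $R^c\equiv0$ on the connected component of $M$ containing $p$. In particular, $g$ is flat Kähler on that connected component.
   Context: The metric $g$ is extended complex bilinearly to $TM\otimes_{\mathbb R}\mathbb C$, and $\|X\|^2=g(X,\overline X)$ for $X\in T^{1,0}M$. $R^c$ is the curvature of the Chern connection (with $R(X,Y)=\nabla_X\nabla_Y-\nabla_Y\nabla_X-\nabla_{[X,Y]}$ and $R^c(X,\overline Y,Z,\overline W)=g(R^c(X,\overline Y)Z,\overline W)$), and $T$ is the torsion of the Chern connection, a section of $\Lambda^2(T^{1,0}M)^*\otimes T^{1,0}M$. $H^c\equiv0$ means $H^c(X)=R^c(X,\overline X,X,\overline X)/\|X\|^4=0$ for all nonzero $X\in T^{1,0}M$. The Bismut connection $\nabla^b$ is the unique Hermitian connection ($\nabla^b g=0$, $\nabla^b J=0$) with totally skew-symmetric torsion $T^b$; $g$ is BTP if $\nabla^bT^b=0$, equivalently $\nabla^bT=0$. $g$ is balanced if $d\omega^{n-1}=0$ for its Hermitian form $\omega$; equivalently $\sum_iT^i_{ik}=0$ for all $k$ in any local unitary frame $e_1,\dots,e_n$, where $T(e_i,e_k)=\sum_jT^j_{ik}e_j$. For a BTP metric, $[x,y]:=T_p(x,y)$ is a complex Lie bracket on $T^{1,0}_pM$, and $\mathfrak g_p=(T^{1,0}_pM,T_p)$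 is called the torsion Lie algebra at $p$. *)

(* Defs.v *)
From HB Require Import structures.
From mathcomp Require Export all_boot all_order all_algebra all_fingroup.
From mathcomp Require Export all_classical all_reals all_analysis.
From mathcomp Require Export complex.
Export Order.TTheory GRing.Theory Num.Theory numFieldNormedType.Exports.

Set Implicit Arguments.
Unset Strict Implicit.
Unset Printing Implicit Defensive.

Local Open Scope classical_set_scope.
Local Open Scope ring_scope.

(* Tangent vectors are row vectors of components in the real coordinate frame
   of a chart; a linear map acts by right multiplication by its matrix, as in
   [jacobian]. *)

Section Calculus.
Variables (R : realType) (m : nat).
Local Notation V := 'rV[R]_m.

Fixpoint Ck (W : normedModType R) (k : nat) (U : set V) (f : V -> W) : Prop :=
  if k is k'.+1 then
    (forall x, U x -> differentiable f x) /\
    (forall a : 'I_m, Ck k' U ('D_(delta_mx 0 a) f))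
  else forall x, U x -> {for x, continuous f}.

Definition smooth (W : normedModType R) (U : set V) (f : V -> W) : Prop :=
  forall k, Ck k U f.

Definition lie_bracket (X Y : V -> V) : V -> V :=
  fun x => 'D_(X x) Y x - 'D_(Y x) X x.

(* Christoffel symbols in a chart: [row b (G x a)] is the vector
   nabla_(d_a) d_b at x. *)
Definition christoffel := V -> 'I_m -> 'M[R]_m.

Definition christ (G : christoffel) (x u v : V) : V :=
  \sum_a u 0 a *: (v *m G x a).

Definition nabla (G : christoffel) (X Y : V -> V) : V -> V :=
  fun x => 'D_(X x) Y x + christ G x (X x) (Y x).

Definition torsion (G : christoffel) (X Y : V -> V) : V -> V :=
  fun x => nabla G X Y x - nabla G Y X x - lie_bracket X Y x.

Definition curvature (G : christoffel) (X Y Z : V -> V) : V -> V :=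
  fun x => nabla G X (nabla G Y Z) x - nabla G Y (nabla G X Z) x
           - nabla G (lie_bracket X Y) Z x.

(* (nabla_X T)(Y, Z) for the torsion T of the same connection. *)
Definition nabla_torsion (G : christoffel) (X Y Z : V -> V) : V -> V :=
  fun x => nabla G X (torsion G Y Z) x
           - torsion G (nabla G X Y) Z x - torsion G Y (nabla G X Z) x.

(* Torsion, curvature and nabla_torsion are tensorial, so their values on
   tangent vectors at x are obtained by extending the vectors to constant
   fields. *)
Definition torsion_at G (x u v : V) : V := torsion G (cst u) (cst v) x.

Definition curvature_at G (x u v w : V) : V :=
  curvature G (cst u) (cst v) (cst w) x.

Definition nabla_torsion_at G (x u v w : V) : V :=
  nabla_torsion G (cst u) (cst v) (cst w) x.

(* p-forms at a point, as functions of p tangent vectors; that they are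
   alternating multilinear is not part of the type. *)
Definition form (p : nat) := ('I_p -> V) -> R.

Definition wedge p q (alpha : form p) (beta : form q) : form (p + q) :=
  fun v => ((p`! * q`!)%:R)^-1 *
    \sum_(s : 'S_(p + q)) (-1) ^+ s *
      (alpha (fun i => v (s (lshift q i))) *
       beta (fun j => v (s (rshift p j)))).

Fixpoint wedge_pow (alpha : form 2) (k : nat) : form (k * 2) :=
  if k is k'.+1 then wedge alpha (@wedge_pow alpha k') else fun=> 1.

(* Exterior derivative: the brackets in the invariant formula vanish because
   the arguments are extended to constant fields. *)
Definition ext_d p (alpha : V -> form p) (x : V) : form p.+1 :=
  fun v => \sum_(i < p.+1) (-1) ^+ i *
    'D_(v i) (fun y => alpha y (fun j => v (lift i j)) : R^o) x.

End Calculus.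
Arguments wedge_pow {R m} alpha k.

(* Multiplication by i on C^n = R^n x R^n: (x, y) |-> (-y, x). *)
Definition Jmx (K : pzRingType) (n : nat) : 'M[K]_(n + n) :=
  block_mx 0 1%:M (- 1%:M) 0.

(* C^n is identified with R^n x R^n; a transition map is holomorphic iff it is
   smooth with complex linear differential. Only the values of [chart i] on
   [dom i], and of [param i] on the image of [dom i], are meaningful. *)
Record complexManifold (R : realType) (n : nat) := ComplexManifold {
  carrier :> topologicalType;
  carrier_hausdorff : hausdorff_space carrier;
  carrier_second_countable : @second_countable carrier;
  chart_index : Type;
  dom : chart_index -> set carrier;
  chart : chart_index -> carrier -> 'rV[R]_(n + n);
  param : chart_index -> 'rV[R]_(n + n) -> carrier;
  dom_open : forall i, open (dom i);
  dom_cover : forall x, exists i, dom i x;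
  chart_open : forall i, open (chart i @` dom i);
  chartK : forall i x, dom i x -> param i (chart i x) = x;
  chart_continuous : forall i x, dom i x -> {for x, continuous (chart i)};
  param_continuous : forall i u, (chart i @` dom i) u ->
    {for u, continuous (param i)};
  transition_smooth : forall i j,
    smooth (chart i @` (dom i `&` dom j)) (chart j \o param i);
  transition_holomorphic : forall i j u, (chart i @` (dom i `&` dom j)) u ->
    Jmx R n *m jacobian (chart j \o param i) u =
    jacobian (chart j \o param i) u *m Jmx R n
}.
Arguments chart {R n} _ _ _.
Arguments param {R n} _ _ _.
Arguments dom {R n} _ _ _.

Section Hermitian.
Variables (R : realType) (n : nat) (M : complexManifold R n).
Local Notation V := 'rV[R]_(n + n).
Local Notation C := R[i].
Local Notation VC := 'rV[C]_(n + n).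
Local Notation J := (Jmx R n).

Definition chart_range (i : chart_index M) : set V := chart M i @` dom M i.
Definition overlap (i j : chart_index M) : set V :=
  chart M i @` (dom M i `&` dom M j).
Definition transition (i j : chart_index M) : V -> V := chart M j \o param M i.

(* [gram i x] is the Gram matrix of the Riemannian metric in chart i at the
   point of coordinates x. *)
Record hermitianMetric := HermitianMetric {
  gram : chart_index M -> V -> 'M[R]_(n + n);
  gram_smooth : forall i, smooth (chart_range i) (gram i);
  gram_sym : forall i x, chart_range i x -> (gram i x)^T = gram i x;
  gram_pos : forall i x, chart_range i x -> forall v : V, v != 0 ->
    0 < (v *m gram i x *m v^T) 0 0;
  gram_J : forall i x, chart_range i x -> J *m gram i x *m J^T = gram i x;
  gram_transition : forall i j x, overlap i j x ->
    gram i x = jacobian (transition i j) x *m gram j (transition i j x)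
               *m (jacobian (transition i j) x)^T
}.

(* Affine connections on the tangent bundle. The transition law says that
   nabla_u v, for v constant in chart i, is mapped by the differential of the
   transition map to the covariant derivative, in chart j, of the image of v. *)
Record connection := Connection {
  symbols :> chart_index M -> christoffel R (n + n);
  symbols_smooth : forall i a, smooth (chart_range i) (fun x => symbols i x a);
  symbols_transition : forall i j x, overlap i j x -> forall u v : V,
    christ (symbols i) x u v *m jacobian (transition i j) x =
    'D_u (fun y => v *m jacobian (transition i j) y) x +
    christ (symbols j) (transition i j x) (u *m jacobian (transition i j) x)
                                      (v *m jacobian (transition i j) x)
}.

Definition toC (u : V) : VC := map_mx (real_complex R) u.
Definition conjv (X : VC) : VC := map_mx (@conjc R) X.

Definition T10 : {vspace VC} :=
  passmx.leigenspace (linfun (mulmxr (Jmx C n))) 'i%C.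

Implicit Types (g : hermitianMetric) (D : connection).

Definition metric g i (x u v : V) : R := (u *m gram g i x *m v^T) 0 0.

(* Complex multilinear extensions of g, of the torsion and of the curvature. *)
Definition metricC g i (x : V) (X Y : VC) : C :=
  (X *m map_mx (real_complex R) (gram g i x) *m Y^T) 0 0.

Definition torsionC D i (x : V) (X Y : VC) : VC :=
  \sum_a \sum_b (X 0 a * Y 0 b) *:
    toC (torsion_at (D i) x (delta_mx 0 a) (delta_mx 0 b)).

Definition curvatureC D i (x : V) (X Y Z : VC) : VC :=
  \sum_a \sum_b \sum_c (X 0 a * Y 0 b * Z 0 c) *:
    toC (curvature_at (D i) x (delta_mx 0 a) (delta_mx 0 b) (delta_mx 0 c)).

Definition metric_connection g D : Prop :=
  forall i x, chart_range i x -> forall u v w : V,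
    'D_u (fun y => metric g i y v w : R^o) x =
    metric g i x (nabla (D i) (cst u) (cst v) x) w +
    metric g i x v (nabla (D i) (cst u) (cst w) x).

Definition complex_connection D : Prop :=
  forall i x, chart_range i x -> forall u v : V,
    nabla (D i) (cst u) (cst (v *m J)) x =
    nabla (D i) (cst u) (cst v) x *m J.

Definition hermitian_connection g D : Prop :=
  metric_connection g D /\ complex_connection D.

(* The Chern connection is the Hermitian connection whose torsion has no
   (1,1)-part. *)
Definition chern_connection g D : Prop :=
  hermitian_connection g D /\
  forall i x, chart_range i x -> forall X Y, X \in T10 -> Y \in T10 ->
    torsionC D i x X (conjv Y) = 0.

Definition bismut_connection g D : Prop :=
  hermitian_connection g D /\
  forall i x, chart_range i x -> forall u v w : V,
    metric g i x (torsion_at (D i) x u v) w =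
      - metric g i x (torsion_at (D i) x v u) w /\
    metric g i x (torsion_at (D i) x u v) w =
      - metric g i x (torsion_at (D i) x u w) v.

Definition levi_civita_connection g D : Prop :=
  metric_connection g D /\
  forall i x, chart_range i x -> forall u v : V, torsion_at (D i) x u v = 0.

Definition parallel_torsion D : Prop :=
  forall i x, chart_range i x -> forall u v w : V,
    nabla_torsion_at (D i) x u v w = 0.

(* omega(u, v) = g(Ju, v) *)
Definition kahler_form g i (x : V) : form R (n + n) 2 :=
  fun v => metric g i x (v 0 *m J) (v 1).

Definition balanced g : Prop :=
  forall i x, chart_range i x -> forall v,
    ext_d (fun y => wedge_pow (kahler_form g i y) n.-1) x v = 0.

Definition curvature4 g D i (x : V) (X Y Z W : VC) : C :=
  metricC g i x (curvatureC D i x X Y Z) W.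

(* metricC g i x X (conjv X) is the square of the norm of X. *)
Definition hol_sect_curvature g D i (x : V) (X : VC) : C :=
  curvature4 g D i x X (conjv X) X (conjv X) / metricC g i x X (conjv X) ^+ 2.

Definition zero_hol_sect_curvature g D : Prop :=
  forall i x, chart_range i x -> forall X, X \in T10 -> X != 0 ->
    hol_sect_curvature g D i x X = 0.

(* Lower central series of T10 with the bracket given by the torsion of D; by
   bilinearity, brackets of basis vectors span all brackets. *)
Fixpoint torsion_lcs D i (x : V) (k : nat) : {vspace VC} :=
  if k is k'.+1 then
    <<[seq torsionC D i x X Y | X <- vbasis T10,
                                Y <- vbasis (torsion_lcs D i x k')]>>%VS
  else T10.

Definition torsion_nilpotent D (p : M) : Prop :=
  forall i, dom M i p -> exists k, torsion_lcs D i (chart M i p) k = 0%VS.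

Definition torsion_free_on D (A : set M) : Prop :=
  forall q, A q -> forall i, dom M i q -> forall X Y, X \in T10 -> Y \in T10 ->
    torsionC D i (chart M i q) X Y = 0.

Definition flat_on D (A : set M) : Prop :=
  forall q, A q -> forall i, dom M i q -> forall u v w : V,
    curvature_at (D i) (chart M i q) u v w = 0.

Definition kahler_on g (A : set M) : Prop :=
  forall q, A q -> forall i, dom M i q -> forall v,
    ext_d (kahler_form g i) (chart M i q) v = 0.

End Hermitian.

(* Main.v *)
From HB Require Import structures.
Require Import Defs.
From mathcomp Require Import ring lra.

Set Implicit Arguments.
Unset Strict Implicit.
Unset Printing Implicit Defensive.

Local Open Scope classical_set_scope.
Local Open Scope ring_scope.

(** Write T for the torsion of the Bismut connection, a parallel 3-form once an
    index is lowered, K for its curvature, and T_u for v |-> T(u, v).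

    The Chern connection is nabla^b + A, where A_u = - 1/2 (T_u - J T_u J) is minus
    the complex linear part of T_u ([chern_symbols]).  As A is parallel, the Chern
    curvature is K(u, v) + A_(T(u, v)) + [A_u, A_v] ([curv_add], [chern_curv]).
    Hence H^c = 0, that is R^c(u, Ju, u, Ju) = 0 for real u ([real_sectional_eq0]),
    is at each point an algebraic condition on T and K.  Moreover K is skew, commutes
    with J, satisfies a first Bianchi identity whose right-hand side is a
    quadratic totally skew expression in T, so that it has the pair symmetry
    ([curvature_pair_sym]), and acts on T by derivations because T is parallel
    ([parallel_curv]).

    The heart of the proof is algebra at one point.  Let z be central in the torsion
    Lie algebra and B u = T(u, z).  Then B is skew and anticommutes with J, while
    A_z = 0.  Polarizing R^c(u, Ju, u, Ju) = 0 in bidegree (2, 2) at z and w and using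
    the Bianchi identity gives K(z, Jz) = 1/2 J B^2 ([central_curvature]).  This
    operator kills z and is a derivation of T, so it commutes with B; since B
    anticommutes with J this says J B^3 = 0, and B = 0 because B is skew
    ([central_torsion0]).  As T is a 3-form, z is thus orthogonal to all brackets.

    In a nilpotent Lie algebra the last nonzero term of the lower central series, if
    it is not the first one, is made of central combinations of brackets; these are
    now orthogonal to themselves, so all brackets vanish ([nilpotent_torsion_eq0]).
    Every vector is then central and T = 0 at p ([nilpotent_bismut_tors0]).

    A parallel tensor that vanishes at a point vanishes near it, by uniqueness for
    linear differential equations along segments ([parallel_zero_near]), and the
    vanishing of T does not depend on the chart, so it spreads over the connected
    component ([torsion_vanishes_component]).  Where T = 0 every vector is central,
    so K(z, Jz) = 0 for all z, and polarization with the pair symmetry gives K = 0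
    ([flat_of_torsion0]).  The Chern, Bismut and Levi-Civita curvatures agree there,
    and the Kaehler form is closed because it is parallel for a connection without
    torsion ([kahler_form_closed]). *)

(** * Bilinear maps and the algebra of a parallel skew torsion *)

(** A predicate on bare functions rather than a structure: it is mostly applied to
    families of maps depending on a point, which carry no canonical instance. *)
Definition bilinear2 (R : pzRingType) (V W : lmodType R) (f : V -> V -> W) :=
  (forall v, linear (f^~ v)) /\ (forall u, linear (f u)).

Section Bilinear2.
Variables (R : pzRingType) (V W : lmodType R) (f : V -> V -> W).
Hypothesis fb : bilinear2 f.
Lemma bi2Dl u u' v : f (u + u') v = f u v + f u' v.
Proof. by have := fb.1 v 1 u u'; rewrite /= !scale1r. Qed.
Lemma bi2Dr u v v' : f u (v + v') = f u v + f u v'.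
Proof. by have := fb.2 u 1 v v'; rewrite /= !scale1r. Qed.
Lemma bi2_0l v : f 0 v = 0.
Proof. by apply: (addIr (f 0 v)); rewrite add0r -bi2Dl addr0. Qed.
Lemma bi2_0r u : f u 0 = 0.
Proof. by apply: (addIr (f u 0)); rewrite add0r -bi2Dr addr0. Qed.
Lemma bi2Zl a u v : f (a *: u) v = a *: f u v.
Proof. by have := fb.1 v a u 0; rewrite /= addr0 bi2_0l addr0. Qed.
Lemma bi2Zr a u v : f u (a *: v) = a *: f u v.
Proof. by have := fb.2 u a v 0; rewrite /= addr0 bi2_0r addr0. Qed.
Lemma bi2Nl u v : f (- u) v = - f u v.
Proof. by rewrite -scaleN1r bi2Zl scaleN1r. Qed.
Lemma bi2Nr u v : f u (- v) = - f u v.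
Proof. by rewrite -scaleN1r bi2Zr scaleN1r. Qed.
Lemma bi2Bl u u' v : f (u - u') v = f u v - f u' v.
Proof. by rewrite bi2Dl bi2Nl. Qed.
Lemma bi2Br u v v' : f u (v - v') = f u v - f u v'.
Proof. by rewrite bi2Dr bi2Nr. Qed.
End Bilinear2.

Lemma linear_sum_delta (R : pzRingType) m (W : lmodType R) (f : 'rV[R]_m -> W) u :
  linear f -> f u = \sum_a u 0 a *: f (delta_mx 0 a).
Proof.
move=> fl; pose L := GRing.isLinear.Build _ _ _ _ f fl.
pose f' : {linear 'rV[R]_m -> W} := HB.pack f L.
by rewrite {1}[u]row_sum_delta -[LHS]/(f' _) linear_sum; apply: eq_bigr => k _;
   rewrite linearZ.
Qed.

Section TorsionAlgebra.
Variables (R : realFieldType) (V : lmodType R).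
Variables (g : V -> V -> R) (J : V -> V) (T : V -> V -> V) (K : V -> V -> V -> V).
Hypothesis gb : @bilinear2 R V R^o g.
Hypothesis gC : forall u v, g u v = g v u.
Hypothesis g_gt0 : forall u, u != 0 -> 0 < g u u.
Hypothesis J_lin : linear J.
Hypothesis JJ : forall u, J (J u) = - u.
Hypothesis gJ : forall u v, g (J u) (J v) = g u v.
Hypothesis Tb : bilinear2 T.
Hypothesis TC : forall u v, T u v = - T v u.
Hypothesis gT : forall u v w, g (T u v) w = - g (T u w) v.

Lemma linear_fun_add u v : J (u + v) = J u + J v.
Proof. by have := J_lin 1 u v; rewrite !scale1r. Qed.
Lemma linear_fun0 : J 0 = 0.
Proof. by apply: (addIr (J 0)); rewrite add0r -linear_fun_add addr0. Qed.
Lemma linear_fun_scale a u : J (a *: u) = a *: J u.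
Proof. by have := J_lin a u 0; rewrite addr0 linear_fun0 addr0. Qed.
Lemma linear_fun_opp u : J (- u) = - J u.
Proof. by rewrite -scaleN1r linear_fun_scale scaleN1r. Qed.
Lemma J_skew u v : g (J u) v = - g u (J v).
Proof. by rewrite -gJ JJ (bi2Nl gb). Qed.

Lemma halfvD (v : V) : 2^-1 *: (v + v) = v.
Proof. by rewrite -mulr2n -[v *+ 2]scaler_nat scalerA mulVf ?scale1r ?pnatr_eq0. Qed.

Lemma form_eq0 u : (forall v, g u v = 0) -> u = 0.
Proof. by move=> h; apply/eqP; apply: contraT => /g_gt0; rewrite h ltxx. Qed.
Lemma form_inj u v : (forall w, g u w = g v w) -> u = v.
Proof.
by move=> h; apply/subr0_eq/form_eq0 => w; rewrite (bi2Bl gb) h subrr.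
Qed.

(** The difference of the Chern and Bismut connections: minus the complex linear part
    of v |-> T(u, v). *)
Definition chernDiff u v := - 2^-1 *: (T u v - J (T u (J v))).

(** Curvature of the connection nabla + A, when A is parallel for nabla and nabla has
    torsion T and curvature K. *)
Definition chernCurv u v w := K u v w + chernDiff (T u v) w
  + (chernDiff u (chernDiff v w) - chernDiff v (chernDiff u w)).

Hypothesis K_bilin : forall w, bilinear2 (fun u v => K u v w).
Hypothesis K_lin : forall u v, linear (K u v).
Hypothesis KC : forall u v w, K u v w = - K v u w.
Hypothesis gK : forall u v w x, g (K u v w) x = - g w (K u v x).
Hypothesis KJ : forall u v w, K u v (J w) = J (K u v w).
Hypothesis bianchi : forall u v w, K u v w + K v w u + K w u v =
  T (T u v) w + T (T v w) u + T (T w u) v.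
Hypothesis KT : forall u v w x,
  K u v (T w x) = T (K u v w) x + T w (K u v x).
Hypothesis chernCurv0 : forall u, g (chernCurv u (J u) u) (J u) = 0.

Lemma chernDiff_bilinear : bilinear2 chernDiff.
Proof.
split=> [v a u u'|u a v v']; rewrite /chernDiff.
  by rewrite !(bi2Dl Tb) !(bi2Zl Tb) linear_fun_add linear_fun_scale opprD
    addrACA -scalerBr scalerDr
     !scalerA mulrC.
by rewrite linear_fun_add linear_fun_scale !(bi2Dr Tb) !(bi2Zr Tb)
  linear_fun_add linear_fun_scale opprD addrACA -scalerBr scalerDr
     !scalerA mulrC.
Qed.

Lemma chernDiffJ u v : chernDiff u (J v) = J (chernDiff u v).
Proof.
by rewrite /chernDiff linear_fun_scale linear_fun_add linear_fun_opp !JJ (bi2Nr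
  Tb) linear_fun_opp !opprK addrC.
Qed.

Lemma torsion_form_skew u v w : g (T u v) w = - g v (T u w).
Proof. by rewrite gT gC. Qed.

Lemma torsion_form_shift u v w : g (T u v) w = g u (T v w).
Proof. by rewrite TC (bi2Nl gb) torsion_form_skew opprK. Qed.

(** The complex linear part of a skew operator is skew, because J is. *)
Lemma chernDiff_skew u v w : g (chernDiff u v) w = - g v (chernDiff u w).
Proof.
rewrite /chernDiff (bi2Zl gb) (bi2Zr gb) (bi2Bl gb) (bi2Br gb) J_skew.
rewrite -[g v (J _)]opprK -[- g v (J _)]J_skew [g (T u v) w]torsion_form_skew
  [g (T u (J v)) _]torsion_form_skew.
by rewrite /GRing.scale /=; ring.
Qed.

Section Polarize.
Variable F : V -> V -> V -> V -> R.
Hypotheses (F1 : forall v w x u u', F (u + u') v w x = F u v w x + F u' v w x)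
 (F2 : forall v w x u u', F v (u + u') w x = F v u w x + F v u' w x)
 (F3 : forall v w x u u', F v w (u + u') x = F v w u x + F v w u' x)
 (F4 : forall v w x u u', F v w x (u + u') = F v w x u + F v w x u').
Hypothesis F0 : forall u, F u u u u = 0.
(** Half the sum of the values at z + w and z - w isolates the part of even degree in
    w; the terms of degree 0 and 4 vanish by hypothesis. *)
Lemma quartic_polarize z w :
  F z z w w + F w w z z + F z w w z + F w z z w + F z w z w + F w z w z = 0.
Proof.
have N1 v w' x u : F (- u) v w' x = - F u v w' x.
  by apply/eqP; rewrite -subr_eq0 opprK -F1 addNr;
     apply/eqP/(addIr (F 0 v w' x)); rewrite -F1 !add0r.
have N2 v w' x u : F v (- u) w' x = - F v u w' x.
  by apply/eqP; rewrite -subr_eq0 opprK -F2 addNr;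
     apply/eqP/(addIr (F v 0 w' x)); rewrite -F2 !add0r.
have N3 v w' x u : F v w' (- u) x = - F v w' u x.
  by apply/eqP; rewrite -subr_eq0 opprK -F3 addNr;
     apply/eqP/(addIr (F v w' 0 x)); rewrite -F3 !add0r.
have N4 v w' x u : F v w' x (- u) = - F v w' x u.
  by apply/eqP; rewrite -subr_eq0 opprK -F4 addNr;
     apply/eqP/(addIr (F v w' x 0)); rewrite -F4 !add0r.
have e : F (z + w) (z + w) (z + w) (z + w) + F (z - w) (z - w) (z - w) (z - w) =
  2 * F z z z z + 2 * F w w w w + 2 * (F z z w w + F w w z z + F z w w z
    + F w z z w + F z w z w + F w z w z).
  by rewrite !F1 !F2 !F3 !F4 !N1 !N2 !N3 !N4; ring.
move: e; rewrite !F0 addr0 !mulr0 !add0r => /esym/eqP.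
by rewrite mulf_eq0 pnatr_eq0 => /eqP.
Qed.
End Polarize.

(** The classical octahedron argument survives the torsion: the right-hand side of the
    Bianchi identity, paired with a fourth vector, is the 4-form obtained by skewing
    g(T(a, b), T(c, d)), and its four instances cancel with the signs below. *)
Lemma curvature_pair_sym u v w x : g (K u v w) x = g (K w x u) v.
Proof.
have bi a b c d : g (K a b c) d + g (K b c a) d + g (K c a b) d =
    g (T a b) (T c d) + g (T b c) (T a d) + g (T c a) (T b d).
  by rewrite -!(bi2Dl gb) bianchi !(bi2Dl gb) !(torsion_form_shift (T _ _)).
have s a b c d : g (K a b c) d = - g (K a b d) c by rewrite gK gC.
have k a b c d : g (K a b c) d = - g (K b a c) d by rewrite KC (bi2Nl gb).
have t a b c d : g (T a b) (T c d) = - g (T b a) (T c d)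
  by rewrite TC (bi2Nl gb).
have t' a b c d : g (T a b) (T c d) = - g (T a b) (T d c)
  by rewrite [T c d]TC (bi2Nr gb).
have := bi u v w x; have := bi v w x u; have := bi w x u v;
have := bi x u v w.
have := s u v w x; have := s v w u x; have := s w u v x; have := k w u x v;
have := s w x v u; have := s x v w u; have := k x v u w; have := s x u w v.
have := t' v w x u; have := t' w x v u; have := gC (T w x) (T u v);
have := t x v w u; have := t' v x w u; have := gC (T v x) (T u w).
have := t x u w v; have := t' u x w v; have := gC (T u x) (T v w);
have := t' u w x v; have := gC (T u w) (T v x); have := t x u v w;
have := t' u v x w; have := t w u v x.
lra.
Qed.

Section Central.
Variable z : V.
Hypothesis z_central : forall v, T z (J v) = - T (J z) v.

Lemma central_TJJ v : T (J z) (J v) = T z v.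
Proof. by rewrite -[LHS]opprK -z_central JJ (bi2Nr Tb) opprK. Qed.

(** Centrality for the complex bracket only says T(z, Jv) = - T(Jz, v); the total
    skewness of T turns it into the statement that T_z anticommutes with J, i.e. that
    the complex linear part of T_z vanishes. *)
Lemma central_TJ v : T z (J v) = - J (T z v).
Proof.
apply: form_inj => w; have [x ->] : exists x, w = J x.
  by exists (- J w); rewrite linear_fun_opp JJ opprK.
by rewrite (bi2Nl gb) gJ z_central (bi2Nl gb) gT opprK central_TJJ gT.
Qed.

Lemma central_TJl v : T (J z) v = J (T z v).
Proof. by rewrite -[LHS]opprK -z_central central_TJ opprK. Qed.

Lemma central_chernDiff v : chernDiff z v = 0.
Proof. by rewrite /chernDiff central_TJ linear_fun_opp JJ opprK subrr scaler0. Qed.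

Lemma central_chernDiffJ v : chernDiff (J z) v = 0.
Proof. by rewrite /chernDiff central_TJJ central_TJl subrr scaler0. Qed.

Lemma central_torsionJl u : T (J u) z = - J (T u z).
Proof. by rewrite TC central_TJ opprK [T u z]TC linear_fun_opp opprK. Qed.

Lemma central_torsionJr u : T u (J z) = J (T u z).
Proof. by rewrite TC central_TJl [T u z]TC linear_fun_opp. Qed.

Lemma chernDiff_central u : chernDiff u z = - T u z.
Proof.
by rewrite /chernDiff central_torsionJr JJ opprK scaleNr halfvD.
Qed.

Lemma torsion_self_skew u w : g (T u z) w = - g u (T w z).
Proof. by rewrite gT torsion_form_shift. Qed.

Lemma torsion_diag : T z z = 0.
Proof.
have := TC z z => /eqP; rewrite -subr_eq0 opprK -mulr2n -scaler_nat scaler_eq0.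
by rewrite pnatr_eq0 => /eqP.
Qed.

Lemma central_torsionJ_diag : T (J z) z = 0.
Proof. by rewrite central_torsionJl torsion_diag linear_fun0 oppr0. Qed.

Lemma chernCurv_centrall u v : chernCurv z u v = K z u v + chernDiff (T z u) v.
Proof.
by rewrite /chernCurv !central_chernDiff (bi2_0r chernDiff_bilinear) subrr addr0.
Qed.

Lemma chernCurv_centralr u v :
  chernCurv u (J z) v = K u (J z) v + chernDiff (J (T u z)) v.
Proof.
by rewrite /chernCurv !central_chernDiffJ (bi2_0r chernDiff_bilinear) subrr addr0
  central_torsionJr.
Qed.

Lemma form_chernDiffJB w : g (chernDiff (J (T w z)) w) (J z) = - g (T w z) (T w z).
Proof.
rewrite chernDiff_skew chernDiffJ chernDiff_central central_torsionJl opprK JJ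
  (bi2Nr gb) opprK.
by rewrite gC torsion_self_skew.
Qed.

Lemma form_chernDiffJB' w : g (chernDiff (J (T w z)) z) (J w) = - g (T w z) (T w z).
Proof. by rewrite chernDiff_central central_torsionJl opprK gJ torsion_self_skew. Qed.

Lemma central_TJB w : T z (J w) = J (T w z).
Proof. by rewrite central_TJ [T z w]TC linear_fun_opp opprK. Qed.

(** The six terms of the polarized condition R^c(u, Ju, u, Ju) = 0.  With B = T(., z)
    one has A_z = A_(Jz) = 0 and A_u z = - B u, so that each correction to K is a
    multiple of |B w|^2: in total 2 - 4 = - 2. *)
Lemma chernCurv_quartic w : [/\
   g (chernCurv z (J z) w) (J w) = g (K z (J z) w) (J w),
   g (chernCurv w (J w) z) (J z) = g (K w (J w) z) (J z) + g (T w z) (T w z) *+ 2,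
   g (chernCurv z (J w) w) (J z) = g (K z (J w) w) (J z) - g (T w z) (T w z) /\
   g (chernCurv w (J z) z) (J w) = g (K w (J z) z) (J w) - g (T w z) (T w z),
   g (chernCurv z (J w) z) (J w) = g (K z (J w) z) (J w) - g (T w z) (T w z) &
   g (chernCurv w (J z) w) (J z) = g (K w (J z) w) (J z) - g (T w z) (T w z)].
Proof.
split; [| |split| |].
all: try rewrite chernCurv_centrall.
all: try rewrite chernCurv_centralr.
- by rewrite central_TJB torsion_diag linear_fun0 (bi2_0l chernDiff_bilinear) addr0.
- have e1 : g (chernDiff (T w (J w)) z) (J z) = 0.
    by rewrite chernDiff_central (bi2Nl gb) torsion_self_skew
      central_torsionJ_diag (bi2_0r gb) !oppr0.
  have e2 : g (chernDiff w (chernDiff (J w) z)) (J z) = g (T w z) (T w z).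
    rewrite chernDiff_skew chernDiffJ !chernDiff_central central_torsionJl
      linear_fun_opp.
    by rewrite !(bi2Nl gb) !(bi2Nr gb) !opprK gJ.
  have e3 : g (chernDiff (J w) (chernDiff w z)) (J z) = - g (T w z) (T w z).
    rewrite chernDiff_skew chernDiffJ !chernDiff_central central_torsionJl
      !linear_fun_opp JJ.
    by rewrite !(bi2Nl gb) !(bi2Nr gb) !opprK.
  rewrite /chernCurv !(bi2Dl gb) (bi2Nl gb) e1 e2 e3 opprK addr0.
  by rewrite mulr2n.
- by rewrite central_TJB (bi2Dl gb) form_chernDiffJB.
- by rewrite (bi2Dl gb) form_chernDiffJB'.
- by rewrite central_TJB (bi2Dl gb) form_chernDiffJB'.
- by rewrite (bi2Dl gb) form_chernDiffJB.
Qed.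

Lemma chernCurv_additive :
  [/\ forall u u' v w, chernCurv (u + u') v w = chernCurv u v w + chernCurv u' v w,
      forall u v v' w, chernCurv u (v + v') w = chernCurv u v w + chernCurv u v' w &
      forall u v w w', chernCurv u v (w + w') = chernCurv u v w + chernCurv u v w'].
Proof.
have cb := chernDiff_bilinear.
have e (a b c d e f h i : V) : a + b + (c + d) + (e + f - (h + i)) =
  a + c + (e - h) + (b + d + (f - i)) :> V.
  by rewrite opprD [a + b + (c + d)]addrACA [e + f + _]addrACA [LHS]addrACA.
split=> [u u' v w|u v v' w|u v w w'].
- by rewrite /chernCurv (bi2Dl (K_bilin w)) (bi2Dl Tb) !(bi2Dl cb) (bi2Dr cb) e.
- by rewrite /chernCurv (bi2Dr (K_bilin w)) (bi2Dr Tb) !(bi2Dl cb) (bi2Dr cb) e.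
- have := K_lin u v 1 w w'; rewrite !scale1r => Kd.
  by rewrite /chernCurv Kd !(bi2Dr cb) e.
Qed.

(** Put s = K(z, Jz, w, Jw), r = K(z, Jw, z, Jw) and k = K(z, w, z, w).  The pair
    symmetry and the J-invariance reduce the polarized condition to
    2 s + 4 r = 2 |B w|^2, and at Jw to 2 s + 4 k = 2 |B w|^2; the Bianchi identity
    reads s - r - k = - 2 |B w|^2.  Solving gives s = - 1/2 |B w|^2. *)
Lemma central_sectional w :
  g (K z (J z) w) (J w) = - 2^-1 * g (T w z) (T w z).
Proof.
have [c1 c2 c3] := chernCurv_additive.
have P w' : g (chernCurv z (J z) w') (J w') + g (chernCurv w' (J w') z) (J z)
   + g (chernCurv z (J w') w') (J z) + g (chernCurv w' (J z) z) (J w')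
   + g (chernCurv z (J w') z) (J w') + g (chernCurv w' (J z) w') (J z) = 0.
  refine (@quartic_polarize (fun a b c d => g (chernCurv a (J b) c) (J d))
    _ _ _ _ _ z w') => [v x y u u'|v x y u u'|v x y u u'|v x y u u'|u] /=.
  - by rewrite c1 (bi2Dl gb).
  - by rewrite linear_fun_add c2 (bi2Dl gb).
  - by rewrite c3 (bi2Dl gb).
  - by rewrite linear_fun_add (bi2Dr gb).
  - exact: chernCurv0.
have s a b c d : g (K a b c) d = - g (K a b d) c by rewrite gK gC.
have k a b c d : g (K a b c) d = - g (K b a c) d by rewrite KC (bi2Nl gb).
have j a b c d : g (K a b (J c)) (J d) = g (K a b c) d by rewrite KJ gJ.
have jl a b c d : g (K (J a) (J b) c) d = g (K a b c) d.
  by rewrite curvature_pair_sym j curvature_pair_sym.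
have jw a b c d : g (K a (J b) c) d = g (K b (J a) c) d.
  by rewrite -jl JJ k (bi2Nl (K_bilin c)) (bi2Nl gb) opprK.
have jz a b c d : g (K a b c) (J d) = g (K a b d) (J c).
  by rewrite -j JJ (bi2Nr gb) s opprK.
(* the polarized condition, divided by two *)
have Q w' : g (K z (J z) w') (J w') + g (K z (J w') z) (J w') *+ 2
  = g (T w' z) (T w' z).
  have := P w'; have [-> -> [-> ->] -> ->] := chernCurv_quartic w'.
  rewrite [g (K w' (J w') z) _]curvature_pair_sym [g (K w' (J z) z) _]jw.
  rewrite [g (K w' (J z) w') _]jw [g (K z (J w') w') _]jz; lra.
have := Q w; have := Q (J w).
have := bianchi z (J z) w => /(congr1 (fun x => g x (J w))).
rewrite !(bi2Dl gb).
have -> : T z (J z) = 0 by rewrite central_torsionJr torsion_diag linear_fun0.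
rewrite central_TJl (bi2_0l Tb) (bi2_0l gb) add0r [T z w]TC linear_fun_opp (bi2Nl Tb).
rewrite central_torsionJl opprK central_torsionJr gJ torsion_self_skew.
rewrite [K (J z) w z]KC (bi2Nl gb) jw j [K w z z]KC (bi2Nl gb).
rewrite j !JJ central_torsionJl !(bi2Nl gb, bi2Nr gb, bi2Nr (K_bilin _)) !opprK gJ; lra.
Qed.

Lemma central_curvature w : K z (J z) w = 2^-1 *: J (T (T w z) z).
Proof.
have c u v : g (K z (J z) u) (J v) = - 2^-1 * g (T u z) (T v z).
  have := central_sectional (u + v); have := central_sectional u.
  have := central_sectional v.
  have := K_lin z (J z) 1 u v; rewrite !scale1r => ->.
  rewrite linear_fun_add !(bi2Dl Tb) !(bi2Dl gb) !(bi2Dr gb).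
  have -> : g (K z (J z) v) (J u) = g (K z (J z) u) (J v).
    by rewrite gK KJ -J_skew gC.
  rewrite [g (T v z) (T u z)]gC; lra.
apply: form_inj => v.
have [x ->] : exists x, v = J x by exists (- J v); rewrite linear_fun_opp JJ opprK.
by rewrite c (bi2Zl gb) gJ [g (T (T _ _) _) _]torsion_self_skew /GRing.scale /=; ring.
Qed.

(** The derivation K(z, Jz) = 1/2 J B^2 kills z, hence commutes with B = T(., z).
    Since B anticommutes with J, this forces J B^3 = 0, and a skew operator with
    B^3 = 0 is zero. *)
Lemma central_torsion0 u : T u z = 0.
Proof.
have Kz : K z (J z) z = 0 by rewrite central_curvature torsion_diag (bi2_0l Tb)
  linear_fun0 scaler0.
have B3 w : T (T (T w z) z) z = 0.
  have := KT z (J z) w z; rewrite Kz (bi2_0r Tb) addr0 !central_curvature.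
  rewrite (bi2Zl Tb) central_torsionJl scalerN => /eqP; rewrite -subr_eq0 opprK
    -scalerDr.
  rewrite halfvD => /eqP /(congr1 J) /eqP.
  by rewrite JJ linear_fun0 oppr_eq0 => /eqP.
have sq w : T (T w z) z = 0 -> T w z = 0.
  move=> e; apply/eqP; apply: contraT => /g_gt0.
  by rewrite torsion_self_skew e (bi2_0r gb) oppr0 ltxx.
exact/sq/sq/B3.
Qed.
End Central.

(** Without torsion every vector is central, so K(u, Ju) = 0 for all u.  Polarizing at
    u - Jv and using K(u, Jv) = K(v, Ju) leaves 2 K(u, v) = 0. *)
Lemma flat_of_torsion0 : (forall u v, T u v = 0) -> forall u v w, K u v w = 0.
Proof.
move=> T0.
have d u w : K u (J u) w = 0.
  by rewrite central_curvature ?T0 ?linear_fun0 ?scaler0 // => v; rewrite !T0 oppr0.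
have jw u v w : K u (J v) w = K v (J u) w.
  apply: form_inj => x; rewrite [LHS]curvature_pair_sym [RHS]curvature_pair_sym.
  by rewrite gK KJ -J_skew gC.
move=> u v w; apply: form_eq0 => x.
have := d (u - J v) w.
rewrite linear_fun_add linear_fun_opp JJ opprK (bi2Dl (K_bilin w)) !(bi2Dr
  (K_bilin w)) !(bi2Nl (K_bilin w)) !d.
rewrite add0r [K (J v) v w]KC d !oppr0 addr0 jw JJ (bi2Nr (K_bilin w)) opprK.
by move/(congr1 ( *:%R 2^-1)); rewrite halfvD scaler0 => ->; rewrite (bi2_0l gb).
Qed.
End TorsionAlgebra.

(** * Symmetry of second derivatives *)

Section Schwarz.
Variables (R : realType) (V : normedModType R).
Implicit Types (f : V -> R^o) (x y u v : V).

Lemma is_derive_line f y u (s : R) : differentiable f (y + s *: u) ->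
  is_derive (s : R^o) 1 (fun s : R => f (y + s *: u) : R^o) ('D_u f (y + s *: u)).
Proof.
move=> fd; have du : derivable f (y + s *: u) u by exact: diff_derivable.
have e : (fun h : R => h^-1 *: (((fun s : R => f (y + s *: u)) \o shift s) (h *: 1)
   - f (y + s *: u))) =
  (fun h : R => h^-1 *: ((f \o shift (y + s *: u)) (h *: u) - f (y + s *: u))).
  apply/funext => h /=; rewrite scalerDl -[h *: 1]/(h * 1) mulr1.
  by rewrite addrCA.
by split; rewrite /derivable /derive e.
Qed.

Lemma differentiable_estimate (W : normedModType R) (F : V -> W) x e :
  differentiable F x -> 0 < e ->
  \forall p \near 0, `|F (x + p) - F x - 'D_p F x| <= e * `|p|.
Proof.
move=> Fd e0; have := diff_locally Fd => /eqaddoP /(_ e e0).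
apply: filterS => p; rewrite deriveE // -[(_ - _) p]/(F (p + x) - (F x + 'd F x p)).
by rewrite opprD addrA [p + x]addrC.
Qed.

(** The mean value theorem in the direction u turns the second difference into a first
    difference of 'D_u f; only the differentiability of 'D_u f at the point x itself is
    then needed to compare it with h^2 'D_v ('D_u f) x. *)
Lemma schwarz_estimate f x u v : (\forall y \near x, differentiable f y) ->
  differentiable ('D_u f) x -> forall e, 0 < e -> \forall h \near 0^'+,
  `|f (x + h *: u + h *: v) - f (x + h *: u) - (f (x + h *: v) - f x)
    - h ^+ 2 * 'D_v ('D_u f) x| <= e * h ^+ 2.
Proof.
move=> fd Fd e e0.
(* c bounds the total length of the two displacements divided by h, plus one to make
   it positive. *)
set F := 'D_u f; set c := 2 * `|u| + `|v| + 1.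
have c0 : 0 < c by rewrite ltr_wpDl ?ltr01 // addr_ge0 // mulr_ge0.
have ec0 : 0 < e / c by rewrite divr_gt0.
have [d1 /= d10 Fo] := (nbhs_ballP _ _).1 (differentiable_estimate Fd ec0).
have [d2 /= d20 fd2] := (nbhs_ballP _ _).1 fd.
near=> h.
have h0 : 0 < h by [].
have small s t : `|s| <= h -> `|t| <= h -> `|s *: u + t *: v| < Num.min d1 d2.
  move=> sh th; apply: le_lt_trans (_ : h * c < _).
    apply: le_trans (ler_normD _ _) _; rewrite !normrZ /c.
    rewrite 2!mulrDr mulr1 -[leLHS]addr0; apply: lerD (ltW h0).
    apply: lerD (ler_wpM2r _ th) => //; apply: le_trans (ler_wpM2r _ sh) _ => //.
    by rewrite ler_pM2l // ler_peMl // ler1n.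
  rewrite -ltr_pdivlMr //; near: h; apply: nbhs_right_lt.
  by rewrite divr_gt0 // lt_min d10.
have dl s t : `|s| <= h -> `|t| <= h -> differentiable f (x + s *: u + t *: v).
  move=> sh th; apply: fd2; rewrite -ball_normE /= -addrA opprD addNKr normrN.
  by have := small s t sh th; rewrite lt_min => /andP[].
have h0n : `|0 : R| <= h by rewrite normr0 ltW.
have hn : `|h| <= h by rewrite gtr0_norm.
pose phi (s : R) : R^o := f ((x + h *: v) + s *: u) - f (x + s *: u).
pose dphi (s : R) := F ((x + h *: v) + s *: u) - F (x + s *: u).
have dphiP (s : R) : `|s| <= h -> is_derive (s : R^o) 1 phi (dphi s).
  move=> sh; apply: is_deriveB; apply: is_derive_line.
    by rewrite addrAC; apply: dl.
  by have := dl s 0 sh h0n; rewrite scale0r addr0.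
have itvn s : s \in `[0, h] -> `|s| <= h.
  by rewrite in_itv /= => /andP[s0 sh]; rewrite ger0_norm.
have [|||xi xih] := @MVT_segment R phi dphi 0 h.
- exact: ltW.
- move=> s /subset_itv_oo_cc sh; apply: dphiP; exact: itvn.
- apply: derivable_within_continuous => s /itvn sh.
  by have /@ex_derive := dphiP s sh.
rewrite subr0 /phi scale0r !addr0 => phiE.
have -> : f (x + h *: u + h *: v) - f (x + h *: u) - (f (x + h *: v) - f x)
   = dphi xi * h by rewrite -phiE [x + h *: u + _]addrAC.
have xin := itvn _ xih.
have est s t : `|s| <= h -> `|t| <= h ->
    `|F (x + (s *: u + t *: v)) - F x - 'D_(s *: u + t *: v) F x| <=
     e / c * `|s *: u + t *: v|.
  move=> sh th; apply: Fo; rewrite -ball_normE /= sub0r normrN.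
  by have := small s t sh th; rewrite lt_min => /andP[].
have e1 := est xi h xin hn; have e2 := est xi 0 xin h0n.
have lin s t : 'D_(s *: u + t *: v) F x = s * 'D_u F x + t * 'D_v F x.
  by rewrite !deriveE // linearD !linearZ.
rewrite !lin scale0r addr0 mul0r addr0 in e1 e2.
have dE : dphi xi * h - h ^+ 2 * 'D_v F x =
  h * ((F (x + (xi *: u + h *: v)) - F x - (xi * 'D_u F x + h * 'D_v F x))
     - (F (x + xi *: u) - F x - xi * 'D_u F x)).
  have aux (k t a b c' U W : R) : (a - b) * k - k ^+ 2 * W =
    k * ((a - c' - (t * U + k * W)) - (b - c' - t * U)) by ring.
  by rewrite /dphi [x + (_ + _)]addrA [x + h *: v + _]addrAC; exact: aux.
rewrite dE normrM (gtr0_norm h0) expr2 mulrCA; apply: ler_wpM2l; first exact: ltW.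
apply: le_trans (ler_normB _ _) _.
apply: le_trans (lerD e1 e2) _; rewrite -mulrDr.
have -> : e * h = e / c * (h * c) by rewrite [h * c]mulrC mulrA divfK ?(lt0r_neq0 c0).
apply: ler_wpM2l; first exact: ltW.
have n1 : `|xi *: u + h *: v| <= h * `|u| + h * `|v|.
  apply: le_trans (ler_normD _ _) _; rewrite !normrZ (gtr0_norm h0) lerD2r.
  exact: ler_wpM2r.
have n2 : `|xi *: u| <= h * `|u| by rewrite normrZ; exact: ler_wpM2r.
apply: le_trans (lerD n1 n2) _.
by rewrite /c -!mulrDr ler_pM2l // mulr2n mulrDl mul1r [leLHS]addrAC
   lerDl.
Unshelve. all: by end_near. Qed.

(** Both mixed derivatives are the limit of the same second difference, which is
    symmetric in u and v. *)
Lemma derive_comm f x u v : (\forall y \near x, differentiable f y) ->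
  differentiable ('D_u f) x -> differentiable ('D_v f) x ->
  'D_v ('D_u f) x = 'D_u ('D_v f) x.
Proof.
move=> fd ud vd; apply/eqP; rewrite -subr_eq0 -normr_le0.
apply/ler_addgt0Pr => e e0; rewrite add0r.
have e20 : 0 < e / 2 by rewrite divr_gt0.
have S1 := schwarz_estimate v fd ud e20.
have S2 := schwarz_estimate u fd vd e20.
have [h [[/= h0 e1] e2]] := filter_ex (filterI (filterI (nbhs_right_gt 0) S1) S2).
have h2 : 0 < h ^+ 2 by rewrite exprn_gt0.
rewrite [x + h *: v + _]addrAC in e2.
rewrite -(ler_pM2l h2) -{1}(gtr0_norm h2) -normrM.
have -> : h ^+ 2 * ('D_v ('D_u f) x - 'D_u ('D_v f) x) =
  (f (x + h *: u + h *: v) - f (x + h *: v) - (f (x + h *: u) - f x)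
    - h ^+ 2 * 'D_u ('D_v f) x)
  - (f (x + h *: u + h *: v) - f (x + h *: u) - (f (x + h *: v) - f x)
    - h ^+ 2 * 'D_v ('D_u f) x).
  have aux (k a b c d p q : R) : k * (p - q) =
    (a - b - (c - d) - k * q) - (a - c - (b - d) - k * p) by ring.
  exact: aux.
apply: le_trans (ler_normB _ _) _; apply: le_trans (lerD e2 e1) _.
by rewrite -mulrDl -splitr mulrC.
Qed.
End Schwarz.

(** * Connections on an open set of a vector space *)

Section Toolkit.
Variable R : realType.

(** Differentiability is local; here it serves to transfer it along an identity that
    holds on an open set only. *)
Lemma near_eq_differentiable (V W : normedModType R) (f g : V -> W) x :
  {near x, f =1 g} -> differentiable f x -> differentiable g x.
Proof.
move=> fg fd; have dc := diff_continuous fd.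
have E : g \o shift x = cst (g x) + 'd f x +o_ 0 id.
  have gx : f x = g x by exact: nbhs_singleton fg.
  have fg' : \forall p \near (0 : V), f (p + x) = g (p + x).
    by have := fg; rewrite (near_shift 0) subr0.
  apply/eqaddoP => e e0.
  have H : \forall p \near (0 : V),
      `|f (p + x) - (f x + 'd f x p)| <= e * `|p|.
    by have /eqaddoP /(_ e e0) := diff_locally fd.
  suff : \forall p \near (0 : V), `|g (p + x) - (g x + 'd f x p)| <= e * `|p|.
    by [].
  by apply: filterS2 fg' H => p <-; rewrite -gx.
have dE := diff_unique dc E.
by apply/diff_locallyP; rewrite dE.
Qed.

Section Rows.
Variables (V : normedModType R) (m : nat).
Implicit Types (F q : V -> 'rV[R]_m) (x a : V).

Lemma differentiable_rowE F x k : differentiable F x ->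
  differentiable (fun y => F y 0 k : R^o) x.
Proof.
move=> Fd; apply: (@differentiable_comp _ _ _ _ F (fun M : 'rV[R]_m => M 0 k :
  R^o)) => //.
exact: differentiable_coord.
Qed.

Lemma differentiable_row F x :
  (forall k, differentiable (fun y => F y 0 k : R^o) x) -> differentiable F x.
Proof.
move=> Fd; rewrite (_ : F = \sum_k (fun y => F y 0 k *: delta_mx 0 k)); last first.
  by apply/funext => y; rewrite fct_sumE -row_sum_delta.
by apply: differentiable_sum => k; exact: differentiableZl.
Qed.

Lemma derive_rowE F x a k : differentiable F x ->
  ('D_a F x) 0 k = 'D_a (fun y => F y 0 k : R^o) x.
Proof. by move=> Fd; rewrite derive_mx ?mxE //; exact: diff_derivable. Qed.

(** Leibniz rule for y |-> Phi y (q y) when every Phi y is linear: it is the sum of the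
    derivatives with q frozen and with Phi frozen. *)
Section Family.
Variables (Phi : V -> 'rV[R]_m -> R^o) (q : V -> 'rV[R]_m) (x : V).
Hypothesis Philin : forall y, linear (Phi y : _ -> R^o).
Hypothesis Phid : forall v, differentiable (fun y => Phi y v) x.
Hypothesis qd : differentiable q x.

Let Phi_sum y v : Phi y v = \sum_k v 0 k * Phi y (delta_mx 0 k).
Proof. exact: (linear_sum_delta v (Philin y)). Qed.

Let Phi_funE : (fun y => Phi y (q y)) =
  \sum_k ((fun y => q y 0 k : R^o) * (fun y => Phi y (delta_mx 0 k))).
Proof. by apply/funext => y; rewrite fct_sumE Phi_sum. Qed.

Lemma differentiable_family_num : differentiable (fun y => Phi y (q y)) x.
Proof.
rewrite Phi_funE; apply: differentiable_sum => k; apply: differentiableM => //.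
exact: differentiable_rowE.
Qed.

Lemma derive_family_num a : 'D_a (fun y => Phi y (q y)) x =
  'D_a (fun y => Phi y (q x)) x + Phi x ('D_a q x).
Proof.
have e : (fun y => Phi y (q x)) = \sum_k (q x 0 k *: (fun y => Phi y (delta_mx 0 k)))
  by apply/funext => y; rewrite fct_sumE Phi_sum.
rewrite e Phi_funE !derive_sum => [|k|k]; first last.
- by apply: derivableM; apply: diff_derivable => //; exact: differentiable_rowE.
- by apply: derivableZ; exact: diff_derivable.
rewrite [Phi x _]Phi_sum -big_split; apply: eq_bigr => k _ /=.
rewrite deriveM ?deriveZ; try by apply: diff_derivable => //; exact:
  differentiable_rowE.
rewrite derive_rowE //; congr (_ + _); exact: mulrC.
Qed.
End Family.

Section FamilyRow.
Variables (Phi : V -> 'rV[R]_m -> 'rV[R]_m) (q : V -> 'rV[R]_m).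
Variable x : V.
Hypothesis Philin : forall y, linear (Phi y).
Hypothesis Phid : forall v, differentiable (fun y => Phi y v) x.
Hypothesis qd : differentiable q x.

Lemma differentiable_family : differentiable (fun y => Phi y (q y)) x.
Proof.
apply: differentiable_row => k.
apply: (differentiable_family_num (Phi := fun y v => Phi y v 0 k)) => // [y|v].
  by move=> a u v; rewrite Philin !mxE.
exact: differentiable_rowE.
Qed.

Lemma derive_family a : 'D_a (fun y => Phi y (q y)) x =
  'D_a (fun y => Phi y (q x)) x + Phi x ('D_a q x).
Proof.
apply/rowP => k; rewrite [RHS]mxE !derive_rowE //; last exact: differentiable_family.
apply: (derive_family_num (Phi := fun y v => Phi y v 0 k)) => // [y|v].
  by move=> c u v; rewrite Philin !mxE.
exact: differentiable_rowE.
Qed.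
End FamilyRow.
End Rows.
End Toolkit.

(** The next four lemmas are the algebraic part of the identities for curvatures
    below.  There g a b stands for nabla_a b and d a b c for the derivative of
    nabla_b c in the direction a, all fields being constant. *)
Lemma bianchi_sum (R : realFieldType) m (g : 'rV[R]_m -> 'rV[R]_m -> 'rV[R]_m)
    (d : 'rV[R]_m -> 'rV[R]_m -> 'rV[R]_m -> 'rV[R]_m)
    (t := fun u v => g u v - g v u) :
  bilinear2 g -> (forall a b c, d a b c - d a c b =
    t (g a b) c + t b (g a c) - g a (t b c)) ->
  forall u v w,
  d u v w - d v u w + (g u (g v w) - g v (g u w))
  + (d v w u - d w v u + (g v (g w u) - g w (g v u)))
  + (d w u v - d u w v + (g w (g u v) - g u (g w v))) =
  t (t u v) w + t (t v w) u + t (t w u) v.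
Proof.
move=> gb D u v w; have := D u v w; have := D v w u; have := D w u v.
rewrite /t !(bi2Bl gb) !(bi2Br gb) => /rowP d1 /rowP d2 /rowP d3.
apply/rowP => k; have := d1 k; have := d2 k; have := d3 k; rewrite !mxE; lra.
Qed.

Lemma parallel_curv_sum (R : realFieldType) m (V := 'rV[R]_m) (g e : V -> V -> V)
    (d : V -> V -> V -> V) (a b u v : V)
    (K := fun w => d a b w - d b a w + (g a (g b w) - g b (g a w)))
    (D := fun a b : V => e (g a (g b u)) v + e (g b u) (g a v) - g a (e (g b u) v)
       + e (d a b u) v
       + (e (g a u) (g b v) + e u (g a (g b v)) - g a (e u (g b v)) + e u (d a b v))
       - (d a b (e u v) + g b (e (g a u) v + e u (g a v) - g a (e u v)))) :
  bilinear2 g -> bilinear2 e -> D a b = D b a -> K (e u v) = e (K u) v + e u (K v).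
Proof.
move=> gb eb; rewrite /D /K.
rewrite !(bi2Dl eb, bi2Dr eb, bi2Bl eb, bi2Br eb, bi2Nl eb, bi2Nr eb).
rewrite !(bi2Dr gb, bi2Br gb, bi2Nr gb).
move=> /rowP E; apply/rowP => k; have := E k; rewrite !mxE; lra.
Qed.

Lemma metric_curv_sum (R : realFieldType) (V : lmodType R) (g : V -> V -> V)
    (h : V -> V -> R^o) (d : V -> V -> V -> V) (a b u v : V)
    (K := fun w => d a b w - d b a w + (g a (g b w) - g b (g a w)))
    (D := fun a b : V => h (g a (g b u)) v + h (g b u) (g a v) + h (d a b u) v
       + (h (g a u) (g b v) + h u (g a (g b v)) + h u (d a b v))) :
  @bilinear2 R V R^o h -> D a b = D b a -> h (K u) v = - h u (K v).
Proof.
move=> hb; rewrite /D /K.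
by rewrite !(bi2Dl hb, bi2Dr hb, bi2Bl hb, bi2Br hb, bi2Nl hb, bi2Nr hb); lra.
Qed.

Lemma curv_add_sum (R : realFieldType) m (V := 'rV[R]_m) (g e : V -> V -> V)
    (d : V -> V -> V -> V) (u v w : V)
    (D := fun u v : V => e (g u v) w + e v (g u w) - g u (e v w)) :
  bilinear2 g -> bilinear2 e ->
  d u v w + D u v - (d v u w + D v u)
  + (g u (g v w + e v w) + e u (g v w + e v w)
     - (g v (g u w + e u w) + e v (g u w + e u w))) =
  d u v w - d v u w + (g u (g v w) - g v (g u w)) + e (g u v - g v u) w
  + (e u (e v w) - e v (e u w)).
Proof.
move=> gb eb; rewrite /D !(bi2Dl eb, bi2Dr eb, bi2Bl eb, bi2Nl eb).
by rewrite !(bi2Dr gb); apply/rowP => k; rewrite !mxE; lra.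
Qed.

(* From here on derivatives are used through their algebraic rules only. *)
#[local] Opaque derive.

Section LocalConnection.
Variables (R : realType) (m : nat).
Local Notation V := 'rV[R]_m.
Variables (U : set V).
Hypothesis Uo : open U.

Lemma derive_eq_on (W : normedModType R) (f h : V -> W) x a :
  (forall y, U y -> f y = h y) -> U x -> 'D_a f x = 'D_a h x.
Proof.
move=> fh Ux; apply: near_eq_derive.
by apply: filterS (open_nbhs_nbhs (conj Uo Ux)) => y; exact: fh.
Qed.

Lemma differentiable_eq_on (W : normedModType R) (f h : V -> W) x :
  (forall y, U y -> f y = h y) -> U x -> differentiable h x -> differentiable f x.
Proof.
move=> fh Ux; apply: near_eq_differentiable.
by apply: filterS (open_nbhs_nbhs (conj Uo Ux)) => y Uy; rewrite fh.
Qed.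

Lemma derive_comm_on (f : V -> R^o) x a b :
  (forall y, U y -> differentiable f y) ->
  (forall y v, U y -> differentiable ('D_v f) y) -> U x ->
  'D_a ('D_b f) x = 'D_b ('D_a f) x.
Proof.
move=> fd Dfd Ux; apply: derive_comm; try exact: Dfd.
by apply: filterS (open_nbhs_nbhs (conj Uo Ux)) => y; exact: fd.
Qed.

Lemma derive_comm_row (f : V -> V) x a b :
  (forall y, U y -> differentiable f y) ->
  (forall y v, U y -> differentiable ('D_v f) y) -> U x ->
  'D_a ('D_b f) x = 'D_b ('D_a f) x.
Proof.
move=> fd Dfd Ux; apply/rowP => k.
apply: (etrans (derive_rowE a k (Dfd x b Ux))).
apply: (etrans _ (esym (derive_rowE b k (Dfd x a Ux)))).
have e v y : U y -> 'D_v f y 0 k = 'D_v (fun y => f y 0 k : R^o) y.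
  by move=> Uy; rewrite derive_rowE //; exact: fd.
apply: (etrans (derive_eq_on a (e b) Ux)).
apply: (etrans _ (esym (derive_eq_on b (e a) Ux))).
apply: derive_comm_on => // y; first by move=> Uy; apply: differentiable_rowE (fd _ Uy).
move=> v Uy; apply: (differentiable_eq_on (h := fun y => 'D_v f y 0 k)) => //.
  by move=> z Uz; rewrite e.
exact/differentiable_rowE/Dfd.
Qed.

Lemma derive_fun_lin (W : normedModType R) (f h : V -> W) x a c :
  differentiable f x -> differentiable h x ->
  'D_a (fun y => c *: f y + h y) x = c *: 'D_a f x + 'D_a h x.
Proof.
move=> fd hd.
have /@derive_val <- : is_derive x a (c *: f + h) (c *: 'D_a f x + 'D_a h x).
  by apply: is_deriveD; [apply: is_deriveZ|]; apply/derivableP/diff_derivable.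
by [].
Qed.

Lemma derive_fun_add (W : normedModType R) (f h : V -> W) x a :
  differentiable f x -> differentiable h x ->
  'D_a (fun y => f y + h y) x = 'D_a f x + 'D_a h x.
Proof. by move=> fd hd; apply: deriveD; exact: diff_derivable. Qed.

Lemma derive_fun_sub (W : normedModType R) (f h : V -> W) x a :
  differentiable f x -> differentiable h x ->
  'D_a (fun y => f y - h y) x = 'D_a f x - 'D_a h x.
Proof. by move=> fd hd; apply: deriveB; exact: diff_derivable. Qed.

Lemma differentiable_fun_add (W : normedModType R) (f h : V -> W) x :
  differentiable f x -> differentiable h x ->
  differentiable (fun y => f y + h y) x.
Proof. exact: differentiableD. Qed.

Lemma differentiable_fun_sub (W : normedModType R) (f h : V -> W) x :
  differentiable f x -> differentiable h x ->
  differentiable (fun y => f y - h y) x.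
Proof. exact: differentiableB. Qed.

Definition tensor_field (E : V -> V -> V -> V) :=
  (forall y, bilinear2 (E y)) /\
  (forall y u v, U y -> differentiable (fun y => E y u v) y).

Section Tensor.
Variable E : V -> V -> V -> V.
Hypothesis Et : tensor_field E.

Lemma differentiable_appr x u (q : V -> V) : U x -> differentiable q x ->
  differentiable (fun y => E y u (q y)) x.
Proof.
move=> Ux qd; apply: (differentiable_family (Phi := fun y => E y u)) => // [y|v].
  exact: (Et.1 y).2.
exact: Et.2.
Qed.

Lemma differentiable_appl x v (q : V -> V) : U x -> differentiable q x ->
  differentiable (fun y => E y (q y) v) x.
Proof.
move=> Ux qd; apply: (differentiable_family (Phi := fun y w => E y w v)) => // [y|w].
  exact: (Et.1 y).1.
exact: Et.2.
Qed.

Lemma derive_appr x u a (q : V -> V) : U x -> differentiable q x ->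
  'D_a (fun y => E y u (q y)) x = 'D_a (fun y => E y u (q x)) x + E x u ('D_a q x).
Proof.
move=> Ux qd; apply: (derive_family (Phi := fun y => E y u)) => // [y|v].
  exact: (Et.1 y).2.
exact: Et.2.
Qed.

Lemma derive_appl x v a (q : V -> V) : U x -> differentiable q x ->
  'D_a (fun y => E y (q y) v) x = 'D_a (fun y => E y (q x) v) x + E x ('D_a q x) v.
Proof.
move=> Ux qd; apply: (derive_family (Phi := fun y w => E y w v)) => // [y|w].
  exact: (Et.1 y).1.
exact: Et.2.
Qed.
End Tensor.

(** For [tors], [curv] and [parallel], a connection is the family G of bilinear maps
    with nabla_u v = G x u v for constant fields u and v; brackets of such fields
    vanish. *)
Definition tors (G : V -> V -> V -> V) x u v := G x u v - G x v u.

Definition curv (G : V -> V -> V -> V) x u v w :=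
  'D_u (fun y => G y v w) x - 'D_v (fun y => G y u w) x
  + (G x u (G x v w) - G x v (G x u w)).

Definition parallel (G E : V -> V -> V -> V) := forall x a u v, U x ->
  'D_a (fun y => E y u v) x = E x (G x a u) v + E x u (G x a v) - G x a (E x u v).

Lemma tors_tensor G : tensor_field G -> tensor_field (tors G).
Proof.
move=> Gt; split=> [y|y u v Uy].
  by split=> [v a u u'|u a v v']; rewrite /tors !(bi2Dl (Gt.1 y), bi2Dr (Gt.1 y),
    bi2Zl (Gt.1 y), bi2Zr (Gt.1 y)) scalerBr opprD addrACA.
apply: differentiableB; exact: Gt.2.
Qed.

Lemma derive_linear (W : normedModType R) (f : V -> W) x : differentiable f x ->
  linear (fun a => 'D_a f x).
Proof. by move=> fd c a b; rewrite !deriveE // linearP. Qed.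

Section Curvature.
Variable G : V -> V -> V -> V.
Hypothesis Gt : tensor_field G.
Let Gb y := Gt.1 y.
Let Gd y u v (Uy : U y) := Gt.2 y u v Uy.
Let Ga y u v (Uy : U y) a := @diff_derivable _ _ _ _ y a (Gt.2 y u v Uy).

Lemma derive_tensor_linl x a w c u v : U x -> 'D_a (fun y => G y (c *: u + v) w) x =
  c *: 'D_a (fun y => G y u w) x + 'D_a (fun y => G y v w) x.
Proof.
move=> Ux; have e : (fun y => G y (c *: u + v) w) =
    (fun y => c *: G y u w + G y v w).
  by apply/funext => y /=; rewrite (Gb y).1.
apply: (etrans (congr1 (fun h : V -> V => 'D_a h x) e)).
by apply: derive_fun_lin; exact: Gd.
Qed.

Lemma derive_tensor_linr x a w c u v : U x -> 'D_a (fun y => G y w (c *: u + v)) x =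
  c *: 'D_a (fun y => G y w u) x + 'D_a (fun y => G y w v) x.
Proof.
move=> Ux; have e : (fun y => G y w (c *: u + v)) =
    (fun y => c *: G y w u + G y w v).
  by apply/funext => y /=; rewrite (Gb y).2.
apply: (etrans (congr1 (fun h : V -> V => 'D_a h x) e)).
by apply: derive_fun_lin; exact: Gd.
Qed.

Lemma curvC x u v w : curv G x u v w = - curv G x v u w.
Proof. by rewrite /curv opprD !opprB. Qed.

Lemma curv_linl x v w : U x -> linear (fun u => curv G x u v w).
Proof.
move=> Ux c u u'; rewrite /curv derive_tensor_linl // (derive_linear (Gd _ _ Ux)).
rewrite !(Gb x).1 (Gb x).2.
move: ('D_u _ x) ('D_u' _ x) ('D_v _ x) ('D_v (fun y => G y u' w) x).
move: (G x u (G x v w)) (G x u' (G x v w)) (G x v (G x u w)) (G x v (G x u' w)) => *.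
by apply/rowP => k; rewrite !mxE; ring.
Qed.

Lemma curv_bilinear x w : U x -> bilinear2 (fun u v => curv G x u v w).
Proof.
move=> Ux; split=> [v|u]; first exact: curv_linl.
move=> c v v'; rewrite !(curvC x u).
by rewrite (curv_linl u w Ux) opprD -scalerN.
Qed.

Lemma curv_lin x u v : U x -> linear (curv G x u v).
Proof.
move=> Ux c w w'; rewrite /curv !derive_tensor_linr // !(Gb x).2.
move: ('D_u _ x) ('D_u (fun y => G y v w') x) ('D_v _ x) ('D_v (fun y => G y u w') x).
move: (G x u (G x v w)) (G x u (G x v w')) (G x v (G x u w)) (G x v (G x u w')) => *.
by apply/rowP => k; rewrite !mxE; ring.
Qed.

(** In the cyclic sum the derivatives of G combine into derivatives of the torsion,
    which the parallelism turns into quadratic expressions in G. *)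
Lemma curv_bianchi x u v w : U x -> parallel G (tors G) ->
  curv G x u v w + curv G x v w u + curv G x w u v =
  tors G x (tors G x u v) w + tors G x (tors G x v w) u + tors G x (tors G x w u) v.
Proof.
move=> Ux P.
have D a b c : 'D_a (fun y => G y b c) x - 'D_a (fun y => G y c b) x =
   tors G x (G x a b) c + tors G x b (G x a c) - G x a (tors G x b c).
  by rewrite -deriveB -?P //; exact: Ga.
exact: (bianchi_sum (g := G x) (d := fun a b c => 'D_a (fun y => G y b c) x)).
Qed.

(** A parallel tensor is automatically twice differentiable: its first derivative is
    an algebraic expression in E and G. *)
Lemma parallel_differentiable E x a u v : tensor_field E -> parallel G E -> U x ->
  differentiable ('D_a (fun y => E y u v)) x.
Proof.
move=> Et P Ux; apply: (differentiable_eq_on (h := fun y =>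
    E y (G y a u) v + E y u (G y a v) - G y a (E y u v)) _ Ux).
  by move=> y Uy; exact: P.
apply: differentiable_fun_sub; [apply: differentiable_fun_add|].
- apply: (differentiable_appl Et _ Ux); exact: Gd.
- apply: (differentiable_appr Et _ Ux); exact: Gd.
- apply: (differentiable_appr Gt _ Ux); exact: Et.2.
Qed.

Lemma parallel_derive2 E x a b u v : tensor_field E -> parallel G E -> U x ->
  'D_a ('D_b (fun y => E y u v)) x =
   E x (G x a (G x b u)) v + E x (G x b u) (G x a v) - G x a (E x (G x b u) v)
       + E x ('D_a (fun y => G y b u) x) v
       + (E x (G x a u) (G x b v) + E x u (G x a (G x b v)) - G x a (E x u (G x b v))
          + E x u ('D_a (fun y => G y b v) x))
       - ('D_a (fun y => G y b (E x u v)) x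
          + G x b (E x (G x a u) v + E x u (G x a v) - G x a (E x u v))).
Proof.
move=> Et P Ux.
have d1 : differentiable (fun y => E y (G y b u) v) x.
  by apply: (differentiable_appl Et _ Ux); exact: Gd.
have d2 : differentiable (fun y => E y u (G y b v)) x.
  by apply: (differentiable_appr Et _ Ux); exact: Gd.
have d3 : differentiable (fun y => G y b (E y u v)) x.
  by apply: (differentiable_appr Gt _ Ux); exact: Et.2.
apply: (etrans (derive_eq_on (h := fun y =>
    E y (G y b u) v + E y u (G y b v) - G y b (E y u v)) a _ Ux)).
  by move=> y Uy; exact: P.
rewrite (derive_fun_sub a (differentiable_fun_add d1 d2) d3).
rewrite (derive_appr Gt b a Ux (Et.2 _ _ _ Ux)) P // (derive_fun_add a d1 d2).
rewrite (derive_appl Et v a Ux (Gd b u Ux)) (derive_appr Et u a Ux (Gd b v Ux)).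
by rewrite !P.
Qed.

(** Ricci identity: differentiating the parallelism equation a second time and
    exchanging the derivatives shows that the curvature acts on E as a derivation. *)
Lemma parallel_curv E x a b u v : tensor_field E -> parallel G E -> U x ->
  curv G x a b (E x u v) = E x (curv G x a b u) v + E x u (curv G x a b v).
Proof.
move=> Et P Ux.
apply: (parallel_curv_sum (d := fun a b c => 'D_a (fun y => G y b c) x)) => //.
  exact: Et.1.
apply: (etrans (esym (parallel_derive2 a b u v Et P Ux))).
apply: (etrans _ (parallel_derive2 b a u v Et P Ux)).
apply: (derive_comm_row a b _ _ Ux) => [y Uy|y c Uy]; first exact: Et.2.
exact: parallel_differentiable.
Qed.

Lemma curv_add E x u v w : tensor_field E -> parallel G E -> U x ->
  curv (fun y u v => G y u v + E y u v) x u v w =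
  curv G x u v w + E x (tors G x u v) w + (E x u (E x v w) - E x v (E x u w)).
Proof.
move=> Et P Ux.
apply: (etrans _ (curv_add_sum (fun a b c => 'D_a (fun y => G y b c) x)
  u v w (Gb x) (Et.1 x))).
have D a b : 'D_a (fun y => G y b w + E y b w) x =
  'D_a (fun y => G y b w) x + (E x (G x a b) w + E x b (G x a w) - G x a (E x b w)).
  rewrite derive_fun_add ?P //; [exact: Gd|exact: Et.2].
by rewrite /curv !D.
Qed.

Section Metric.
Variable h : V -> V -> V -> R^o.
Hypothesis hb : forall y, @bilinear2 R V R^o (h y).
Hypothesis hd : forall y u v, U y -> differentiable (fun y => h y u v) y.
Hypothesis hG : forall y a u v, U y ->
  'D_a (fun y => h y u v) y = h y (G y a u) v + h y u (G y a v).

Lemma metric_differentiable_appl x v (q : V -> V) : U x -> differentiable q x ->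
  differentiable (fun y => h y (q y) v) x.
Proof.
move=> Ux qd; apply: (differentiable_family_num (Phi := fun y w => h y w v)) => //.
  by move=> y; exact: (hb y).1.
by move=> w; exact: hd.
Qed.

Lemma metric_differentiable_appr x u (q : V -> V) : U x -> differentiable q x ->
  differentiable (fun y => h y u (q y)) x.
Proof.
move=> Ux qd; apply: (differentiable_family_num (Phi := fun y w => h y u w)) => //.
  by move=> y; exact: (hb y).2.
by move=> w; exact: hd.
Qed.

Lemma metric_derive2 x a b u v : U x -> 'D_a ('D_b (fun y => h y u v)) x =
  h x (G x a (G x b u)) v + h x (G x b u) (G x a v) + h x ('D_a (fun y => G y b u) x) v
  + (h x (G x a u) (G x b v) + h x u (G x a (G x b v))
     + h x u ('D_a (fun y => G y b v) x)).
Proof.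
move=> Ux; apply: (etrans (derive_eq_on (h := fun y =>
    h y (G y b u) v + h y u (G y b v)) a _ Ux)).
  by move=> y Uy; exact: hG.
apply: (etrans (derive_fun_add _ _ _)).
- by apply: metric_differentiable_appl => //; exact: Gd.
- by apply: metric_differentiable_appr => //; exact: Gd.
congr (_ + _).
  apply: (etrans (derive_family_num (Phi := fun y w => h y w v) _ _ _ _)).
  - by move=> y; exact: (hb y).1.
  - by move=> w; exact: hd.
  - exact: Gd.
  by rewrite hG.
apply: (etrans (derive_family_num (Phi := fun y w => h y u w) _ _ _ _)).
- by move=> y; exact: (hb y).2.
- by move=> w; exact: hd.
- exact: Gd.
by rewrite hG.
Qed.

(** The Ricci identity for a parallel metric. *)
Lemma metric_curv x a b u v : U x ->
  h x (curv G x a b u) v = - h x u (curv G x a b v).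
Proof.
move=> Ux.
apply: (metric_curv_sum (g := G x) (h := h x)
  (d := fun a b c => 'D_a (fun y => G y b c) x) (hb x)).
apply: (etrans (esym (metric_derive2 a b u v Ux))).
apply: (etrans _ (metric_derive2 b a u v Ux)).
apply: (derive_comm_on a b _ _ Ux) => [y Uy|y c Uy]; first exact: hd.
apply: (differentiable_eq_on (h := fun y => h y (G y c u) v + h y u (G y c v)) _ Uy).
  by move=> z Uz; exact: hG.
apply: differentiable_fun_add.
  by apply: metric_differentiable_appl => //; exact: Gd.
by apply: metric_differentiable_appr => //; exact: Gd.
Qed.
End Metric.

Lemma derive_mulmxr (q : V -> V) (M : 'M[R]_m) x a : differentiable q x ->
  'D_a (fun y => q y *m M) x = 'D_a q x *m M.
Proof.
move=> qd; apply: (etrans (derive_family (Phi := fun _ w => w *m M) _ _ qd a)).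
- by move=> _ c u v; rewrite mulmxDl -scalemxAl.
- by move=> v; exact: differentiable_cst.
by rewrite derive_cst add0r.
Qed.

Lemma curv_mulmxr (M : 'M[R]_m) x a b w : U x ->
  (forall y u v, U y -> G y u (v *m M) = G y u v *m M) ->
  curv G x a b (w *m M) = curv G x a b w *m M.
Proof.
move=> Ux GM; rewrite /curv !GM //.
have D c d : 'D_c (fun y => G y d (w *m M)) x = 'D_c (fun y => G y d w) x *m M.
  rewrite -derive_mulmxr; last exact: Gd.
  by apply: derive_eq_on => // y Uy; rewrite GM.
by rewrite !D mulmxDl !mulmxBl.
Qed.
End Curvature.

End LocalConnection.

(** * Bismut, Chern and Levi-Civita connections in one chart *)

Section Uniqueness.
Variables (R : realFieldType) (V : lmodType R) (g : V -> V -> R) (J : V -> V).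
Hypothesis gb : @bilinear2 R V R^o g.
Hypothesis g_gt0 : forall u, u != 0 -> 0 < g u u.
Hypothesis J_lin : linear J.
Hypothesis JJ : forall u, J (J u) = - u.
Hypothesis gJ : forall u v, g (J u) (J v) = g u v.

Section Difference.
Variable B : V -> V -> V.
Hypothesis B_skew : forall u v w, g (B u v) w = - g (B u w) v.

(** The braid argument: a trilinear form symmetric in the first two slots and skew in
    the last two is zero.  It is applied to the difference of two connections. *)
Lemma metric_torsionfree_unique : (forall u v, B u v = B v u) ->
  forall u v, B u v = 0.
Proof.
move=> BC u v; apply: (form_eq0 g_gt0) => w.
have : g (B u v) w = - g (B u v) w.
  by rewrite {1}BC B_skew BC B_skew opprK BC B_skew BC.
lra.
Qed.

(** The difference B of two Hermitian connections with torsion of type (2,0) is complex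
    linear in its first argument too; moving J around the form g(B(u, v), w), which is
    skew in v and w, then changes its sign. *)
Lemma hermitian_torsion20_unique : (forall u v, B u (J v) = J (B u v)) ->
  (forall u v, B (J u) v - B v (J u) = J (B u v - B v u)) ->
  forall u v, B u v = 0.
Proof.
move=> BJ Bt; have BJl u v : B (J u) v = J (B u v).
  by have := Bt u v; rewrite BJ (linear_fun_add J_lin) (linear_fun_opp J_lin) => /addIr.
have z u v : B (J u) v = 0.
  apply: (form_eq0 g_gt0) => w.
  have c a b c' : g (J (B a b)) c' = - g (B a b) (J c') by exact: (J_skew gb JJ gJ).
  have : g (B (J u) v) w = - g (B (J u) v) w.
    by rewrite {1}BJl c B_skew opprK BJ -BJl B_skew.
  lra.
move=> u v; have -> : u = J (- J u) by rewrite (linear_fun_opp J_lin) JJ opprK.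
exact: z.
Qed.
End Difference.
End Uniqueness.

Section ChernTorsion.
Variables (R : realFieldType) (V : lmodType R) (J : V -> V) (T : V -> V -> V).
Hypothesis J_lin : linear J.
Hypothesis JJ : forall u, J (J u) = - u.
Hypothesis Tb : bilinear2 T.
Hypothesis TC : forall u v, T u v = - T v u.

(** The torsion of the connection with difference tensor [chernDiff]. *)
Definition chernTors u v := 2^-1 *: J (T u (J v) + T (J u) v).

Lemma chernDiff_tors u v :
  T u v + chernDiff J T u v - chernDiff J T v u = chernTors u v.
Proof.
rewrite /chernDiff /chernTors [T v u]TC [T v (J u)]TC (linear_fun_opp J_lin)
  opprK (linear_fun_add J_lin).
move: (T u v) (J (T u (J v))) (J (T (J u) v)) => a b c.
rewrite !scaleNr opprK -{1}[a]halfvD -scalerBr -scalerDr opprB.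
by rewrite [a + a + _]addrACA subrr addr0 addrACA subrr add0r.
Qed.

(** The Nijenhuis tensor of J, expressed by the torsion of a connection preserving J.
    It vanishes because J is constant in the chart. *)
Lemma complex_torsion_integrable (G : V -> V -> V) (t := fun u v => G u v - G v u) :
  (forall u v, G u (J v) = J (G u v)) ->
  forall u v, t (J u) (J v) - t u v = J (t (J u) v + t u (J v)).
Proof.
move=> GJ u v; rewrite /t !GJ !(linear_fun_add J_lin) !(linear_fun_opp J_lin)
  !JJ opprK opprB addrACA.
by congr (_ + _); rewrite addrC.
Qed.

(** Without (1,1)-part the torsion satisfies the first two identities; with the
    integrability of J, its (0,2)-part vanishes as well. *)
Lemma torsion20_complex_linear (t : V -> V -> V) :
  (forall u v, t (J u) (J v) = - t u v) -> (forall u v, t u (J v) = t (J u) v) ->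
  (forall u v, t (J u) (J v) - t u v = J (t (J u) v + t u (J v))) ->
  forall u v, t (J u) v = J (t u v).
Proof.
move=> tJJ tJ N u v; have := N u v; rewrite tJJ tJ -opprD.
move=> /(congr1 (fun w => 2^-1 *: J w)); rewrite JJ scalerN halfvD.
by rewrite (linear_fun_opp J_lin) scalerN -(linear_fun_scale J_lin) halfvD => /oppr_inj.
Qed.

Hypothesis integrable :
  forall u v, T (J u) (J v) - T u v = J (T (J u) v + T u (J v)).

Lemma chernTorsJ u v : chernTors (J u) v = J (chernTors u v).
Proof.
by rewrite /chernTors JJ (bi2Nl Tb) integrable (linear_fun_scale J_lin) addrC.
Qed.
End ChernTorsion.

Lemma parallel_linear_part_sum (R : realFieldType) m (M : 'M[R]_m)
    (p q r p' q' r' : 'rV[R]_m) :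
  - 2^-1 *: (p + q - r - (p' + q' - r') *m M) =
  - 2^-1 *: (p - p' *m M) + - 2^-1 *: (q - q' *m M) - - 2^-1 *: (r - r' *m M).
Proof.
rewrite mulmxBl mulmxDl; move: (p' *m M) (q' *m M) (r' *m M) => {}p' {}q' {}r'.
by apply/rowP => k; rewrite !mxE; ring.
Qed.

(** The connections Gb, Gc and G0 play the roles of the Bismut, Chern and Levi-Civita
    connections of the metric h on an open set where J is the constant matrix M. *)
Section LocalBTP.
Variables (R : realType) (m : nat).
Local Notation V := 'rV[R]_m.
Variables (U : set V) (M : 'M[R]_m) (h : V -> V -> V -> R^o).
Variables (Gb Gc G0 : V -> V -> V -> V).
Local Notation J := (fun v : V => v *m M).
Hypothesis Uo : open U.
Hypothesis MM : M *m M = - 1%:M.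
Hypothesis hb : forall y, @bilinear2 R V R^o (h y).
Hypothesis hd : forall y u v, U y -> differentiable (fun y => h y u v) y.
Hypothesis hC : forall y u v, U y -> h y u v = h y v u.
Hypothesis h_gt0 : forall y u, U y -> u != 0 -> 0 < h y u u.
Hypothesis hJ : forall y u v, U y -> h y (J u) (J v) = h y u v.
Hypothesis Gbt : tensor_field U Gb.
Hypothesis h_Gb : forall y a u v, U y ->
  'D_a (fun y => h y u v) y = h y (Gb y a u) v + h y u (Gb y a v).
Hypothesis h_Gc : forall y a u v, U y ->
  'D_a (fun y => h y u v) y = h y (Gc y a u) v + h y u (Gc y a v).
Hypothesis h_G0 : forall y a u v, U y ->
  'D_a (fun y => h y u v) y = h y (G0 y a u) v + h y u (G0 y a v).
Hypothesis GbJ : forall y u v, U y -> Gb y u (J v) = J (Gb y u v).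
Hypothesis GcJ : forall y u v, U y -> Gc y u (J v) = J (Gc y u v).
Let T := tors Gb.
Hypothesis hT : forall y u v w, U y -> h y (T y u v) w = - h y (T y u w) v.
Hypothesis T_parallel : parallel U Gb T.
Hypothesis GcT : forall y u v, U y -> tors Gc y (J u) v = J (tors Gc y u v).
Hypothesis G0T : forall y u v, U y -> tors G0 y u v = 0.

Let J_lin : linear J. Proof. by move=> c u v; rewrite mulmxDl scalemxAl. Qed.
Let JJ u : J (J u) = - u. Proof. by rewrite /= -mulmxA MM mulmxN mulmx1. Qed.
Let Tt : tensor_field U T. Proof. exact: tors_tensor. Qed.
Let TC y u v : T y u v = - T y v u. Proof. by rewrite /T /tors opprB. Qed.

Lemma bismut_integrable y u v : U y ->
  T y (J u) (J v) - T y u v = J (T y (J u) v + T y u (J v)).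
Proof.
move=> Uy; apply: (complex_torsion_integrable J_lin JJ (G := Gb y)).
by move=> a b; exact: GbJ.
Qed.

(** By uniqueness of the Chern connection, it suffices that the right-hand side is
    Hermitian with complex bilinear torsion. *)
Lemma chern_symbols y u v : U y ->
  Gc y u v = Gb y u v + chernDiff J (T y) u v.
Proof.
move=> Uy; pose B u v := Gc y u v - (Gb y u v + chernDiff J (T y) u v).
have Tb := Tt.1 y; have cb := chernDiff_bilinear J_lin Tb.
suff : B u v = 0 by move/eqP; rewrite subr_eq0 => /eqP.
have gTy a b c : h y (T y a b) c = - h y (T y a c) b by exact: hT.
have gC a b : h y a b = h y b a by exact: hC.
have hJy a b : h y (J a) (J b) = h y a b by exact: hJ.
apply: (@hermitian_torsion20_unique _ _ (h y) J) => //; rewrite /B.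
- by move=> a b; apply: h_gt0.
- move=> a b c; have := h_Gc a b c Uy; rewrite h_Gb //.
  have := chernDiff_skew (hb y) gC JJ hJy gTy a b c.
  rewrite !(bi2Bl (hb y)) !(bi2Dl (hb y)).
  rewrite [h y b (Gc _ _ _)]gC [h y b (Gb _ _ _)]gC [h y b (chernDiff _ _ _ _)]gC.
  lra.
- move=> a b; rewrite GcJ // GbJ // (chernDiffJ J_lin) //.
  by rewrite (linear_fun_add J_lin) (linear_fun_opp J_lin) (linear_fun_add J_lin).
move=> a b.
have t c d : Gc y c d - (Gb y c d + chernDiff J (T y) c d)
   - (Gc y d c - (Gb y d c + chernDiff J (T y) d c)) =
   tors Gc y c d - chernTors J (T y) c d.
  rewrite -(chernDiff_tors J_lin (TC y)) /T /tors.
  move: (chernDiff _ _ c d) (chernDiff _ _ d c) => p q.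
  by apply/rowP => k; rewrite !mxE; ring.
rewrite t t GcT // (chernTorsJ J_lin JJ Tb); last first.
  by move=> *; exact: bismut_integrable.
exact: esym (mulmxBl _ _ _).
Qed.

Lemma chern_tors y u v : U y -> tors Gc y u v = chernTors J (T y) u v.
Proof.
move=> Uy; rewrite /tors !chern_symbols // -(chernDiff_tors J_lin (TC y)) /T /tors.
move: (chernDiff _ _ u v) (chernDiff _ _ v u) => p q.
by apply/rowP => k; rewrite !mxE; ring.
Qed.

Lemma levi_civita_symbols y u v : U y ->
  G0 y u v = Gb y u v + - 2^-1 *: T y u v.
Proof.
move=> Uy; pose B u v := G0 y u v - (Gb y u v + - 2^-1 *: T y u v).
suff : B u v = 0 by move/eqP; rewrite subr_eq0 => /eqP.
have gC a b : h y a b = h y b a by exact: hC.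
apply: (@metric_torsionfree_unique _ _ (h y)) => //; rewrite /B.
- by move=> a b; apply: h_gt0.
- move=> a b c; have := h_G0 a b c Uy; rewrite h_Gb //.
  rewrite !(bi2Bl (hb y)) !(bi2Dl (hb y)) !(bi2Zl (hb y)).
  rewrite [h y b (G0 _ _ _)]gC [h y b (Gb _ _ _)]gC /GRing.scale /=.
  have := hT a b c Uy; lra.
move=> a b; have := G0T a b Uy; rewrite /T /tors => /rowP E.
by apply/rowP => k; have := E k; rewrite !mxE; lra.
Qed.

Let E y u v := chernDiff J (T y) u v.

Let Et : tensor_field U E.
Proof.
split=> [y|y u v Uy]; first exact: (chernDiff_bilinear J_lin (Tt.1 y)).
rewrite /E /chernDiff; apply: differentiableZ; apply: differentiable_fun_sub.
  exact: Tt.2.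
apply: (differentiable_family (Phi := fun _ w => w *m M)) => [_|w|].
- exact: J_lin.
- exact: differentiable_cst.
exact: Tt.2.
Qed.

Let E_parallel : parallel U Gb E.
Proof.
move=> y a u v Uy.
have d1 : differentiable (fun y => T y u v) y by exact: Tt.2.
have d2 : differentiable (fun y => T y u (J v)) y by exact: Tt.2.
have d3 : differentiable (fun y => J (T y u (J v))) y.
  apply: (differentiable_family (Phi := fun _ w => w *m M)) => [_|w|//].
    exact: J_lin.
  exact: differentiable_cst.
rewrite /E /chernDiff.
have -> : (fun y => - 2^-1 *: (T y u v - J (T y u (J v)))) =
   (fun y => - 2^-1 *: (T y u v - J (T y u (J v))) + 0).
  by apply/funext => z; rewrite addr0.
rewrite derive_fun_lin; [|exact: differentiable_fun_sub|exact: differentiable_cst].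
rewrite derive_cst addr0 derive_fun_sub // derive_mulmxr // !T_parallel //.
have GJ w : Gb y a (w *m M) = Gb y a w *m M by exact: GbJ.
rewrite /= (bi2Zr (Gbt.1 y)) (bi2Br (Gbt.1 y) a (T y u v)) !GJ.
exact: parallel_linear_part_sum.
Qed.

Lemma curv_eq_on (G G' : V -> V -> V -> V) x u v w :
  (forall y a b, U y -> G y a b = G' y a b) -> U x ->
  curv G x u v w = curv G' x u v w.
Proof.
move=> GG' Ux; have e a b : G x a b = G' x a b by exact: GG'.
have D c a b : 'D_c (fun y => G y a b) x = 'D_c (fun y => G' y a b) x.
  by apply: (derive_eq_on Uo _ _ Ux) => y Uy; exact: GG'.
apply: (f_equal2 +%R (f_equal2 (fun p q => p - q) (D u v w) (D v u w))).
by rewrite (e v w) (e u w) !e.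
Qed.

Lemma chern_curv x u v w : U x ->
  curv Gc x u v w = chernCurv J (T x) (curv Gb x) u v w.
Proof.
move=> Ux; apply: (etrans
  (curv_eq_on (G' := fun y a b => Gb y a b + E y a b) u v w _ Ux)).
  by move=> y a b Uy; exact: chern_symbols.
exact: (curv_add Gbt _ _ _ Et E_parallel Ux).
Qed.

(** The Levi-Civita connection is nabla^b - 1/2 T, so the correction terms to the
    curvature are quadratic in T. *)
Lemma levi_civita_curv x u v w : U x -> (forall a b, T x a b = 0) ->
  curv G0 x u v w = curv Gb x u v w.
Proof.
move=> Ux T0; pose E0 y u v := - 2^-1 *: T y u v.
have E0t : tensor_field U E0.
  split=> [y|y a b Uy]; last by apply: differentiableZ; exact: Tt.2.
  by split=> [b c a a'|a c b b']; rewrite /E0 ((Tt.1 y).1, (Tt.1 y).2) scalerDr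
    !scalerA mulrC.
have E0p : parallel U Gb E0.
  move=> y c a b Uy; rewrite /E0.
  have d : differentiable (fun y => T y a b) y by exact: Tt.2.
  apply: (etrans (deriveZ _ (diff_derivable d))).
  rewrite T_parallel // (bi2Zr (Gbt.1 y)) -scalerDr -scalerBr.
  by [].
apply: (etrans
  (curv_eq_on (G' := fun y a b => Gb y a b + E0 y a b) u v w _ Ux)).
  by move=> y a b Uy; exact: levi_civita_symbols.
apply: (etrans (curv_add Gbt _ _ _ E0t E0p Ux)).
by rewrite /E0 !T0 !scaler0 subrr !addr0.
Qed.

Section AtPoint.
Variable x : V.
Hypothesis Ux : U x.
Hypothesis Hc : forall u, h x (curv Gc x u (J u) u) (J u) = 0.

Let hCx u v : h x u v = h x v u. Proof. exact: hC. Qed.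
Let hJx u v : h x (J u) (J v) = h x u v. Proof. exact: hJ. Qed.
Let hTx u v w : h x (T x u v) w = - h x (T x u w) v. Proof. exact: hT. Qed.
Let K_bilin w : bilinear2 (fun u v => curv Gb x u v w).
Proof. exact: (curv_bilinear Gbt w Ux). Qed.
Let K_lin u v : linear (curv Gb x u v). Proof. exact: (curv_lin Gbt u v Ux). Qed.
Let hK u v w w' : h x (curv Gb x u v w) w' = - h x w (curv Gb x u v w').
Proof. exact: (metric_curv Uo Gbt hb hd h_Gb _ _ _ _ Ux). Qed.
Let KJ u v w : curv Gb x u v (J w) = J (curv Gb x u v w).
Proof. exact: (curv_mulmxr Uo Gbt _ _ _ Ux GbJ). Qed.
Let bianchi u v w : curv Gb x u v w + curv Gb x v w u + curv Gb x w u v =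
  T x (T x u v) w + T x (T x v w) u + T x (T x w u) v.
Proof. exact: (curv_bianchi Gbt _ _ _ Ux T_parallel). Qed.
Let KT u v w w' : curv Gb x u v (T x w w') =
  T x (curv Gb x u v w) w' + T x w (curv Gb x u v w').
Proof. exact: (parallel_curv Uo Gbt _ _ _ _ Tt T_parallel Ux). Qed.
Let Hc_alg u : h x (chernCurv J (T x) (curv Gb x) u (J u) u) (J u) = 0.
Proof. by rewrite -chern_curv. Qed.

Lemma torsion_central_eq0 z : (forall v, tors Gc x z v = 0) ->
  forall u, T x u z = 0.
Proof.
move=> z0.
have zc v : T x z (J v) = - T x (J z) v.
  have := z0 v; rewrite chern_tors // /chernTors => /(congr1 ( *:%R 2)).
  rewrite scaler0 scalerA mulfV ?pnatr_eq0 // scale1r => /(congr1 J).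
  by rewrite /= JJ mul0mx => /eqP; rewrite oppr_eq0 addr_eq0 => /eqP.
exact: (central_torsion0 (hb x) hCx (fun u => @h_gt0 x u Ux) J_lin JJ hJx (Tt.1 x)
  (TC x) hTx K_bilin K_lin (curvC Gb x) hK KJ bianchi KT Hc_alg zc).
Qed.

Lemma torsion_eq0_flat : (forall u v, T x u v = 0) -> forall u v w,
  [/\ curv Gb x u v w = 0, curv Gc x u v w = 0 & curv G0 x u v w = 0].
Proof.
move=> T0 u v w.
have K0 := flat_of_torsion0 (hb x) hCx (fun u => @h_gt0 x u Ux) J_lin JJ hJx (Tt.1 x)
  (TC x) hTx K_bilin K_lin (curvC Gb x) hK KJ bianchi Hc_alg T0.
split=> //; last by rewrite levi_civita_curv.
have A0 a b : chernDiff J (T x) a b = 0.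
  by rewrite /chernDiff !T0 (linear_fun0 J_lin) subr0 scaler0.
by rewrite chern_curv // /chernCurv K0 !A0 subrr !addr0.
Qed.
End AtPoint.

End LocalBTP.

(** * Translation of the coordinate definitions *)

Lemma Jmx_sqr (K : pzRingType) n : Jmx K n *m Jmx K n = - 1%:M.
Proof.
rewrite /Jmx mulmx_block !mul0mx !mulmx0 !mul1mx !mulmx1 !add0r !addr0.
by rewrite (scalar_mx_block n n 1) opp_block_mx !oppr0.
Qed.

Section Christoffel.
Variables (R : realType) (m : nat).
Local Notation V := 'rV[R]_m.
Implicit Types (G : christoffel R m) (x u v w : V).

Lemma christ_bilinear G x : bilinear2 (christ G x).
Proof.
split=> [v a u u'|u a v v']; rewrite /christ scaler_sumr -big_split;
  apply: eq_bigr => k _ /=; rewrite ?mxE ?scalerDl ?scalerA //.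
by rewrite mulmxDl -scalemxAl scalerDr !scalerA mulrC.
Qed.

Lemma nabla_cst G u v : nabla G (cst u) (cst v) = fun x => christ G x u v.
Proof. by apply/funext => x; rewrite /nabla derive_cst add0r. Qed.

Lemma lie_bracket_cst u v : lie_bracket (cst u) (cst v) = fun _ : V => 0 : V.
Proof. by apply/funext => x; rewrite /lie_bracket !derive_cst subrr. Qed.

Lemma torsion_cstE G u v : torsion G (cst u) (cst v) = fun x => tors (christ G) x u v.
Proof.
by apply/funext => x; rewrite /torsion !nabla_cst lie_bracket_cst subr0.
Qed.

Lemma torsion_atE G x u v : torsion_at G x u v = tors (christ G) x u v.
Proof. by rewrite /torsion_at torsion_cstE. Qed.

Lemma curvature_atE G x u v w : curvature_at G x u v w = curv (christ G) x u v w.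
Proof.
rewrite /curvature_at /curvature lie_bracket_cst !nabla_cst /nabla.
rewrite (bi2_0l (christ_bilinear G x)) subr0 /curv.
by rewrite opprD addrACA.
Qed.

Lemma torsionl G (P : V -> V) w x : torsion G P (cst w) x = tors (christ G) x (P x) w.
Proof.
rewrite /torsion /nabla /lie_bracket !derive_cst !add0r /tors /=.
by rewrite opprK opprD [- _ - _]addrC addrA subrK.
Qed.

Lemma torsionr G (P : V -> V) w x : torsion G (cst w) P x = tors (christ G) x w (P x).
Proof.
rewrite /torsion /nabla /lie_bracket !derive_cst !add0r /tors /=.
by rewrite subr0 [X in X - _ - _]addrC addrAC addrK.
Qed.

Lemma nabla_torsion_atE G x u v w : nabla_torsion_at G x u v w =
  'D_u (fun y => tors (christ G) y v w) x + christ G x u (tors (christ G) x v w)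
  - tors (christ G) x (christ G x u v) w - tors (christ G) x v (christ G x u w).
Proof.
rewrite /nabla_torsion_at /nabla_torsion torsionl torsionr !nabla_cst.
by rewrite torsion_cstE /nabla.
Qed.
End Christoffel.

Section Smooth.
Variables (R : realType) (m : nat).
Local Notation V := 'rV[R]_m.

Lemma smooth_differentiable (W : normedModType R) (U : set V) (f : V -> W) x :
  smooth U f -> U x -> differentiable f x.
Proof. by move=> /(_ 1%N) /= [+ _] => /[apply]. Qed.

Lemma differentiable_mx_entry p q (F : V -> 'M[R]_(p, q)) x a b :
  differentiable F x -> differentiable (fun y => F y a b : R^o) x.
Proof.
move=> Fd.
apply: (@differentiable_comp _ _ _ _ F (fun N : 'M[R]_(p, q) => N a b : R^o)) => //.
exact: differentiable_coord.
Qed.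

Lemma differentiable_num_sum I (r : seq I) (F : I -> V -> R^o) x :
  (forall k, differentiable (F k) x) ->
  differentiable (fun y => \sum_(k <- r) F k y : R^o) x.
Proof.
move=> Fd; elim: r => [|k r IH].
  by under eq_fun do rewrite big_nil; exact: differentiable_cst.
under eq_fun do rewrite big_cons; exact: differentiable_fun_add.
Qed.

Lemma differentiable_num_scale (F : V -> R^o) x c :
  differentiable F x -> differentiable (fun y => c * F y : R^o) x.
Proof. by move=> Fd; apply: differentiableZ. Qed.

Lemma christ_tensor_field (U : set V) (G : christoffel R m) :
  (forall a, smooth U (fun x => G x a)) -> tensor_field U (christ G).
Proof.
move=> Gs; split=> [y|y u v Uy]; first exact: christ_bilinear.
apply: differentiable_row => k.
have -> : (fun y => christ G y u v 0 k : R^o) =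
  fun y => \sum_a u 0 a * (\sum_b v 0 b * G y a b k).
  apply/funext => z; rewrite /christ summxE; apply: eq_bigr => a _.
  by rewrite !mxE.
apply: differentiable_num_sum => a; apply: differentiable_num_scale.
apply: differentiable_num_sum => b; apply: differentiable_num_scale.
by apply: differentiable_mx_entry; apply: smooth_differentiable (Gs a) Uy.
Qed.
End Smooth.

Section ChartMetric.
Variables (R : realType) (n : nat) (M : complexManifold R n).
Variables (g : hermitianMetric M) (i : chart_index M).
Local Notation V := 'rV[R]_(n + n).
Local Notation J := (Jmx R n).
Implicit Types x u v w : V.

(** The metric with values in R^o, over which the derivatives are taken. *)
Definition met x u v : R^o := metric g i x u v.

Lemma met_bilinear x : @bilinear2 R V R^o (met x).
Proof.
split=> [v a u u'|u a v v']; rewrite /met /metric.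
  by rewrite !mulmxDl -!scalemxAl !mxE.
by rewrite linearP /= mulmxDr -scalemxAr !mxE.
Qed.

Lemma metE x u v : met x u v = \sum_b (\sum_a u 0 a * gram g i x a b) * v 0 b.
Proof. by rewrite /met /metric !mxE; apply: eq_bigr => b _; rewrite !mxE. Qed.

Lemma met_differentiable x u v : chart_range i x ->
  differentiable (fun y => met y u v) x.
Proof.
move=> Ux.
have -> : (fun y => met y u v) =
   fun y => \sum_b v 0 b * (\sum_a u 0 a * gram g i y a b).
  by apply/funext => y; rewrite metE; apply: eq_bigr => b _; rewrite mulrC.
apply: differentiable_num_sum => b; apply: differentiable_num_scale.
apply: differentiable_num_sum => a; apply: differentiable_num_scale.
by apply: differentiable_mx_entry; apply: smooth_differentiable (gram_smooth g i) Ux.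
Qed.

Lemma metC x u v : chart_range i x -> met x u v = met x v u.
Proof.
move=> Ux; rewrite /met /metric.
have -> : u *m gram g i x *m v^T = (v *m gram g i x *m u^T)^T.
  by rewrite !trmx_mul trmxK (gram_sym g Ux) mulmxA.
by rewrite mxE.
Qed.

Lemma met_gt0 x u : chart_range i x -> u != 0 -> 0 < met x u u.
Proof. by move=> Ux; exact: gram_pos. Qed.

Lemma metJ x u v : chart_range i x -> met x (u *m J) (v *m J) = met x u v.
Proof.
by move=> Ux; rewrite /met /metric trmx_mul -[in RHS](gram_J g Ux) !mulmxA.
Qed.

Variable D : connection M.
Lemma connection_tensor_field : tensor_field (chart_range i) (christ (D i)).
Proof. by apply: christ_tensor_field => a; exact: symbols_smooth. Qed.

Lemma metric_connection_christ : metric_connection g D ->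
  forall x a u v, chart_range i x ->
  'D_a (fun y => met y u v) x = met x (christ (D i) x a u) v + met x u (christ
    (D i) x a v).
Proof. by move=> gD x a u v Ux; have := gD i x Ux a u v; rewrite !nabla_cst. Qed.

Lemma complex_connection_christ : complex_connection D ->
  forall x u v, chart_range i x ->
  christ (D i) x u (v *m J) = christ (D i) x u v *m J.
Proof. by move=> cD x u v Ux; have := cD i x Ux u v; rewrite !nabla_cst. Qed.

Lemma parallel_torsion_christ : parallel_torsion D ->
  parallel (chart_range i) (christ (D i)) (tors (christ (D i))).
Proof.
move=> P x a u v Ux; have /eqP := P i x Ux a u v.
rewrite nabla_torsion_atE -addrA -opprD subr_eq0 => /eqP <-.
by rewrite addrK.
Qed.
End ChartMetric.

(** * Real and imaginary parts, and nilpotency of the torsion algebra *)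

(** Complexified tangent vectors are handled through their real and imaginary parts,
    which reduces statements on complex multilinear extensions to real ones. *)
Section RealParts.
Variables (R : realType) (m : nat).
Local Notation V := 'rV[R]_m.
Local Notation C := R[i].
Local Notation VC := 'rV[C]_m.
Implicit Types (X Y Z : VC) (u v : V).

Definition reV X : V := map_mx (@complex.Re R) X.
Definition imV X : V := map_mx (@complex.Im R) X.

Definition complex_row u v : VC := \row_k (Complex (u 0 k) (v 0 k)).

Lemma reV_complex_row u v : reV (complex_row u v) = u.
Proof. by apply/rowP => k; rewrite !mxE. Qed.
Lemma imV_complex_row u v : imV (complex_row u v) = v.
Proof. by apply/rowP => k; rewrite !mxE. Qed.

Lemma reimP X Y : reV X = reV Y -> imV X = imV Y -> X = Y.
Proof.
move=> /rowP re /rowP im; apply/rowP => k; have := re k; have := im k.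
by rewrite !mxE; case: (X 0 k) => a b; case: (Y 0 k) => c d /= -> ->.
Qed.

Lemma reVD X Y : reV (X + Y) = reV X + reV Y.
Proof. by apply/rowP => k; rewrite !mxE; case: (X 0 k); case: (Y 0 k). Qed.
Lemma imVD X Y : imV (X + Y) = imV X + imV Y.
Proof. by apply/rowP => k; rewrite !mxE; case: (X 0 k); case: (Y 0 k). Qed.
Lemma reV0 : reV 0 = 0. Proof. by apply/rowP => k; rewrite !mxE. Qed.
Lemma imV0 : imV 0 = 0. Proof. by apply/rowP => k; rewrite !mxE. Qed.
Lemma reVZ (c : C) X : reV (c *: X) = complex.Re c *: reV X - complex.Im c *: imV X.
Proof. by apply/rowP => k; rewrite !mxE; case: (X 0 k); case: c. Qed.
Lemma imVZ (c : C) X : imV (c *: X) = complex.Re c *: imV X + complex.Im c *: reV X.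
Proof. by apply/rowP => k; rewrite !mxE; case: (X 0 k); case: c. Qed.
Lemma reV_toC (c : C) u : reV (c *: map_mx (real_complex R) u) = complex.Re c *: u.
Proof. by apply/rowP => k; rewrite !mxE; case: c => a b /=; rewrite mulr0 subr0. Qed.
Lemma imV_toC (c : C) u : imV (c *: map_mx (real_complex R) u) = complex.Im c *: u.
Proof. by apply/rowP => k; rewrite !mxE; case: c => a b /=; rewrite mulr0 add0r. Qed.
Lemma reV_conj X : reV (map_mx (@conjc R) X) = reV X.
Proof. by apply/rowP => k; rewrite !mxE; case: (X 0 k). Qed.
Lemma imV_conj X : imV (map_mx (@conjc R) X) = - imV X.
Proof. by apply/rowP => k; rewrite !mxE; case: (X 0 k). Qed.
Lemma reV_sum I (r : seq I) (F : I -> VC) :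
  reV (\sum_(k <- r) F k) = \sum_(k <- r) reV (F k).
Proof. exact: (big_morph _ reVD reV0). Qed.
Lemma imV_sum I (r : seq I) (F : I -> VC) :
  imV (\sum_(k <- r) F k) = \sum_(k <- r) imV (F k).
Proof. exact: (big_morph _ imVD imV0). Qed.

Lemma reM (a b : C) : complex.Re (a * b) =
  complex.Re a * complex.Re b - complex.Im a * complex.Im b.
Proof. by case: a; case: b. Qed.
Lemma imM (a b : C) : complex.Im (a * b) =
  complex.Re a * complex.Im b + complex.Im a * complex.Re b.
Proof. by case: a => ? ?; case: b => ? ? /=; rewrite addrC. Qed.

Lemma bilinear_sum_delta (W : lmodType R) (f : V -> V -> W) u v : bilinear2 f ->
  f u v = \sum_a \sum_b (u 0 a * v 0 b) *: f (delta_mx 0 a) (delta_mx 0 b).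
Proof.
move=> fb; rewrite (linear_sum_delta u (fb.1 v)); apply: eq_bigr => a _.
rewrite (linear_sum_delta v (fb.2 _)) scaler_sumr; apply: eq_bigr => b _.
by rewrite scalerA.
Qed.

Lemma trilinear_sum_delta (W : lmodType R) (f : V -> V -> V -> W) u v w :
  (forall w, bilinear2 (fun u v => f u v w)) -> (forall u v, linear (f u v)) ->
  f u v w = \sum_a \sum_b \sum_c (u 0 a * v 0 b * w 0 c) *:
    f (delta_mx 0 a) (delta_mx 0 b) (delta_mx 0 c).
Proof.
move=> fb fl; rewrite (bilinear_sum_delta u v (fb w)).
apply: eq_bigr => a _; apply: eq_bigr => b _.
rewrite (linear_sum_delta w (fl _ _)) scaler_sumr; apply: eq_bigr => c _.
by rewrite scalerA.
Qed.

Section Bilinear.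
Variable f : V -> V -> V.
Hypothesis fb : bilinear2 f.
Definition complexify2 X Y : VC := \sum_a \sum_b (X 0 a * Y 0 b) *:
  map_mx (real_complex R) (f (delta_mx 0 a) (delta_mx 0 b)).

Lemma reV_complexify2 X Y :
  reV (complexify2 X Y) = f (reV X) (reV Y) - f (imV X) (imV Y).
Proof.
rewrite !(bilinear_sum_delta _ _ fb) reV_sum -sumrB; apply: eq_bigr => a _.
rewrite reV_sum -sumrB; apply: eq_bigr => b _.
by rewrite reV_toC reM !mxE scalerBl.
Qed.

Lemma imV_complexify2 X Y :
  imV (complexify2 X Y) = f (reV X) (imV Y) + f (imV X) (reV Y).
Proof.
rewrite !(bilinear_sum_delta _ _ fb) imV_sum -big_split; apply: eq_bigr => a _.
rewrite imV_sum -big_split; apply: eq_bigr => b _.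
by rewrite imV_toC imM !mxE scalerDl.
Qed.

Lemma complexify2_bilinear : bilinear2 complexify2.
Proof.
split=> [Y c X X'|X c Y Y']; rewrite /complexify2 scaler_sumr -big_split;
  apply: eq_bigr => a _; rewrite scaler_sumr -big_split; apply: eq_bigr => b _ /=;
  by rewrite !mxE scalerA -scalerDl; congr (_ *: _); ring.
Qed.
End Bilinear.

Section Trilinear.
Variable f : V -> V -> V -> V.
Hypothesis fb : forall w, bilinear2 (fun u v => f u v w).
Hypothesis fl : forall u v, linear (f u v).
Definition complexify3 X Y Z : VC := \sum_a \sum_b \sum_c
  (X 0 a * Y 0 b * Z 0 c) *:
  map_mx (real_complex R) (f (delta_mx 0 a) (delta_mx 0 b) (delta_mx 0 c)).

Lemma reV_complexify3 X Y Z : reV (complexify3 X Y Z) =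
  f (reV X) (reV Y) (reV Z) - f (imV X) (imV Y) (reV Z)
  - (f (reV X) (imV Y) (imV Z) + f (imV X) (reV Y) (imV Z)).
Proof.
rewrite !(trilinear_sum_delta _ _ _ fb fl) reV_sum -!(sumrB, big_split).
apply: eq_bigr => a _; rewrite reV_sum -!(sumrB, big_split).
apply: eq_bigr => b _; rewrite reV_sum -!(sumrB, big_split).
apply: eq_bigr => c _ /=.
move: (f _ _ _) => t; rewrite reV_toC !(reM, imM).
by apply/rowP => k; rewrite !mxE; ring.
Qed.

Lemma imV_complexify3 X Y Z : imV (complexify3 X Y Z) =
  f (reV X) (reV Y) (imV Z) - f (imV X) (imV Y) (imV Z)
  + (f (reV X) (imV Y) (reV Z) + f (imV X) (reV Y) (reV Z)).
Proof.
rewrite !(trilinear_sum_delta _ _ _ fb fl) imV_sum -!(sumrB, big_split).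
apply: eq_bigr => a _; rewrite imV_sum -!(sumrB, big_split).
apply: eq_bigr => b _; rewrite imV_sum -!(sumrB, big_split).
apply: eq_bigr => c _ /=.
move: (f _ _ _) => t; rewrite imV_toC !(reM, imM).
by apply/rowP => k; rewrite !mxE; ring.
Qed.
End Trilinear.

Lemma mulmx_real_entry (X : VC) (A : 'M[R]_m) b :
  (X *m map_mx (real_complex R) A) 0 b =
  Complex ((reV X *m A) 0 b) ((imV X *m A) 0 b).
Proof.
rewrite !mxE; elim/big_ind3: _ => // [x1 y1 z1 x2 y2 z2 -> ->//|k _].
by rewrite !mxE; case: (X 0 k) => a c /=; rewrite /GRing.mul /= !mulr0 subr0 add0r.
Qed.

Lemma reV_mulmx_real X (A : 'M[R]_m) :
  reV (X *m map_mx (real_complex R) A) = reV X *m A.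
Proof. by apply/rowP => k; rewrite [LHS]mxE mulmx_real_entry. Qed.

Lemma imV_mulmx_real X (A : 'M[R]_m) :
  imV (X *m map_mx (real_complex R) A) = imV X *m A.
Proof. by apply/rowP => k; rewrite [LHS]mxE mulmx_real_entry. Qed.

Lemma re_form_real X Y (A : 'M[R]_m) :
  complex.Re ((X *m map_mx (real_complex R) A *m Y^T) 0 0) =
  (reV X *m A *m (reV Y)^T) 0 0 - (imV X *m A *m (imV Y)^T) 0 0.
Proof.
rewrite ![((_ *m _ *m _) 0 0)]mxE -sumrB.
rewrite (big_morph (@complex.Re R) (id1 := 0) (op1 := +%R)) //; last by case=> ? ? [].
apply: eq_bigr => b _; rewrite mulmx_real_entry reM.
by rewrite [Y^T _ _]mxE [(reV Y)^T _ _]mxE [(imV Y)^T _ _]mxE [reV Y _ _]mxE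
  [imV Y _ _]mxE.
Qed.

End RealParts.

Section T10.
Variables (R : realType) (n : nat).
Local Notation V := 'rV[R]_(n + n).
Local Notation VC := 'rV[R[i]]_(n + n).
Local Notation J := (Jmx R n).

Lemma map_Jmx : Jmx R[i] n = map_mx (real_complex R) J.
Proof. by rewrite /Jmx map_block_mx map_mxN !map_mx0 map_mx1. Qed.

(** The vectors of type (1,0) are the u - i Ju with u real. *)
Lemma T10P (X : VC) : reflect (imV X = - (reV X *m J)) (X \in @T10 R n).
Proof.
rewrite /T10 /passmx.leigenspace memv_ker.
rewrite add_lfunE opp_lfunE scale_lfunE id_lfunE lfunE /= subr_eq0 map_Jmx.
apply: (iffP eqP) => [e|im].
  have := congr1 (@reV _ _) e; rewrite reV_mulmx_real reVZ /= scale0r scale1r sub0r.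
  by move=> ->; rewrite opprK.
apply: reimP; rewrite (reV_mulmx_real, imV_mulmx_real) (reVZ, imVZ) /=.
  by rewrite im scale0r scale1r sub0r opprK.
by rewrite im scale0r scale1r add0r mulNmx -mulmxA Jmx_sqr mulmxN mulmx1 opprK.
Qed.

Definition realT10 (u : V) : VC := complex_row u (- (u *m J)).

Lemma realT10_in u : realT10 u \in @T10 R n.
Proof. by apply/T10P; rewrite reV_complex_row imV_complex_row. Qed.
End T10.

Lemma linear_sum_coord (F : fieldType) (V W : lmodType F) (f : V -> W) I (r : seq I)
    (c : I -> F) (b : I -> V) : linear f ->
  f (\sum_(k <- r) c k *: b k) = \sum_(k <- r) c k *: f (b k).
Proof.
move=> fl; pose L := GRing.isLinear.Build _ _ _ _ f fl.
pose f' : {linear V -> W} := HB.pack f L.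
by rewrite -[LHS]/(f' _) linear_sum; apply: eq_bigr => k _; rewrite linearZ.
Qed.

Lemma span_closed (F : fieldType) (V : vectType F) (P : V -> Prop) (s : seq V) :
  P 0 -> (forall c u v, P u -> P v -> P (c *: u + v)) ->
  (forall u, u \in s -> P u) -> forall u, u \in span s -> P u.
Proof.
move=> P0 PD Ps u us; rewrite (coord_span (X := in_tuple s) us).
elim/big_rec: _ => // k v _ Pv; apply: PD => //; apply: Ps; exact: mem_nth.
Qed.

Section ChartTorsion.
Variables (R : realType) (n : nat) (M : complexManifold R n).
Variables (D : connection M) (i : chart_index M) (x : 'rV[R]_(n + n)).
Local Notation V := 'rV[R]_(n + n).
Local Notation VC := 'rV[R[i]]_(n + n).
Local Notation J := (Jmx R n).
Local Notation tau := (tors (christ (D i)) x).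

Let taub : bilinear2 tau.
Proof. exact: (tors_tensor (connection_tensor_field i D)).1. Qed.

Lemma torsionCE X Y : torsionC D i x X Y = complexify2 tau X Y.
Proof.
apply: eq_bigr => a _; apply: eq_bigr => b _.
by rewrite torsion_atE.
Qed.

Lemma torsionC_bilinear : bilinear2 (torsionC D i x).
Proof.
have e : torsionC D i x = complexify2 tau.
  by apply/funext => X; apply/funext => Y; rewrite torsionCE.
by rewrite e; exact: complexify2_bilinear.
Qed.

Lemma chern_torsionJ :
  (forall X Y, X \in @T10 R n -> Y \in @T10 R n -> torsionC D i x X (conjv Y) = 0) ->
  (forall u v, christ (D i) x u (v *m J) = christ (D i) x u v *m J) ->
  forall u v, tau (u *m J) v = tau u v *m J.
Proof.
move=> T11 GJ.
have P u v : tau u (v *m J) = tau (u *m J) v /\ tau (u *m J) (v *m J) = - tau u v.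
  have := T11 _ _ (realT10_in u) (realT10_in v); rewrite torsionCE => Z.
  have := congr1 (@reV _ _) Z; have := congr1 (@imV _ _) Z.
  rewrite reV_complexify2 // imV_complexify2 // !reV_conj !imV_conj
    !reV_complex_row !imV_complex_row.
  rewrite reV0 imV0 opprK !(bi2Nl taub) opprK.
  by move=> /eqP; rewrite subr_eq0 => /eqP -> /eqP; rewrite addrC addr_eq0 => /eqP ->.
have J_lin : linear (fun w : V => w *m J) by move=> c a b; rewrite mulmxDl scalemxAl.
have JJ (a : V) : a *m J *m J = - a by rewrite -mulmxA Jmx_sqr mulmxN mulmx1.
apply: (torsion20_complex_linear J_lin JJ) => [u v|u v|].
- by have [] := P u v.
- by have [] := P u v.
exact: (complex_torsion_integrable J_lin JJ (G := christ (D i) x)).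
Qed.

Lemma T10_torsionC X Y : (forall u v, tau (u *m J) v = tau u v *m J) ->
  X \in @T10 R n -> Y \in @T10 R n -> torsionC D i x X Y \in @T10 R n.
Proof.
move=> tJ /T10P X10 /T10P Y10; apply/T10P.
have tC u v : tau u v = - tau v u by rewrite /tors opprB.
have tJr u v : tau u (v *m J) = tau u v *m J.
  by rewrite tC tJ [tau u v]tC mulNmx.
rewrite torsionCE reV_complexify2 // imV_complexify2 // X10 Y10.
rewrite !(bi2Nl taub) !(bi2Nr taub) opprK !tJ !tJr -!mulmxA Jmx_sqr mulmxN mulmx1.
by rewrite opprK (mulmxDl (tau (reV X) (reV Y)) (tau _ _) J) opprD.
Qed.

Lemma T10_torsionC_re X u : (forall u v, tau (u *m J) v = tau u v *m J) ->
  X \in @T10 R n -> reV (torsionC D i x (realT10 u) X) = tau u (reV X) + tau u (reV X).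
Proof.
move=> tJ /T10P X10.
have tC u' v : tau u' v = - tau v u' by rewrite /tors opprB.
have tJr u' v : tau u' (v *m J) = tau u' v *m J.
  by rewrite tC tJ [tau u' v]tC mulNmx.
rewrite torsionCE reV_complexify2 // reV_complex_row imV_complex_row X10.
by rewrite !(bi2Nl taub) !(bi2Nr taub) opprK tJ tJr -mulmxA Jmx_sqr mulmxN mulmx1 opprK.
Qed.

Lemma torsion_lcs_sub_T10 k : (forall u v, tau (u *m J) v = tau u v *m J) ->
  (torsion_lcs D i x k <= @T10 R n)%VS.
Proof.
move=> tJ; elim: k => [|k IH] /=; first exact: subvv.
apply/span_subvP => _ /allpairsP [[X Y] [/= Xb Yb ->]]; apply: T10_torsionC => //.
  exact: vbasis_mem Xb.
exact: (subvP IH) (vbasis_mem Yb).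
Qed.

Lemma torsion_lcs_bracket k X Y : X \in @T10 R n -> Y \in torsion_lcs D i x k ->
  torsionC D i x X Y \in torsion_lcs D i x k.+1.
Proof.
move=> X10 Yk; rewrite (coord_vbasis X10) (linear_sum_coord _ _ _
  (torsionC_bilinear.1 Y)).
apply: memv_suml => a _; apply: memvZ.
rewrite (coord_vbasis Yk) (linear_sum_coord _ _ _ (torsionC_bilinear.2 _)).
apply: memv_suml => b _; apply: memvZ; apply: memv_span; apply/allpairsP.
exists ((vbasis (@T10 R n))`_a, (vbasis (torsion_lcs D i x k))`_b) => /=.
by split=> //; apply: mem_nth; rewrite size_tuple.
Qed.

Section Nilpotent.
Variable h : V -> V -> R^o.
Hypothesis hb : @bilinear2 R V R^o h.
Hypothesis h_gt0 : forall u, u != 0 -> 0 < h u u.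
Hypothesis tJ : forall u v, tau (u *m J) v = tau u v *m J.
(* This is what the condition H^c = 0 brings, through [torsion_central_eq0]. *)
Hypothesis central_orth : forall z, (forall v, tau z v = 0) ->
  forall u v, h (tau u v) z = 0.

Lemma torsion_lcs_orth k Z z : (forall u v, h (tau u v) z = 0) ->
  Z \in torsion_lcs D i x k.+1 -> h (reV Z) z = 0 /\ h (imV Z) z = 0.
Proof.
move=> hz; apply: (span_closed (P := fun Z => h (reV Z) z = 0 /\ h (imV Z) z = 0)).
- by rewrite reV0 imV0 !(bi2_0l hb).
- move=> c X Y [Xr Xi] [Yr Yi]; rewrite reVD imVD reVZ imVZ !(bi2Dl hb) !(bi2Nl hb).
  by rewrite !(bi2Zl hb) Xr Xi Yr Yi !scaler0 oppr0 !addr0.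
move=> _ /allpairsP [[X Y] [/= _ _ ->]].
rewrite torsionCE reV_complexify2 // imV_complexify2 //.
rewrite (bi2Bl hb (tau (reV X) (reV Y))) (bi2Dl hb (tau (reV X) (imV Y))).
by rewrite !hz subrr addr0.
Qed.

(** Downward induction along the lower central series.  If the term l + 2 vanishes, the
    real and imaginary parts of an element Z of the term l + 1 are central, hence
    orthogonal to all brackets; but Z is a combination of brackets, so it is zero.
    The induction stops at the term 1, which is spanned by all brackets. *)
Lemma nilpotent_torsion_eq0 k : torsion_lcs D i x k = 0%VS -> forall u v, tau u v = 0.
Proof.
have tC u v : tau u v = - tau v u by rewrite /tors opprB.
have central l Z : torsion_lcs D i x l.+1 = 0%VS -> Z \in torsion_lcs D i x l ->
    (forall v, tau (reV Z) v = 0) /\ (forall v, tau (imV Z) v = 0).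
  move=> l0 Zl; have Z10 := subvP (torsion_lcs_sub_T10 l tJ) _ Zl.
  have reZ v : tau (reV Z) v = 0.
    have := torsion_lcs_bracket (realT10_in v) Zl; rewrite l0 memv0 => /eqP.
    move=> /(congr1 (@reV _ _)); rewrite T10_torsionC_re // reV0.
    by move=> /(congr1 ( *:%R 2^-1)); rewrite halfvD scaler0 tC => /eqP;
       rewrite oppr_eq0 => /eqP.
  by split=> // v; rewrite (T10P _ Z10) (bi2Nl taub) tJ reZ mul0mx oppr0.
have step l : torsion_lcs D i x l.+2 = 0%VS -> torsion_lcs D i x l.+1 = 0%VS.
  move=> l0; apply/eqP; rewrite -subv0; apply/subvP => Z Zl; rewrite memv0; apply/eqP.
  have [reZ imZ] := central _ _ l0 Zl.
  have zero z : h z z = 0 -> z = 0.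
    by move=> hz; apply/eqP; apply: contraT => /h_gt0; rewrite hz ltxx.
  apply: reimP; rewrite ?reV0 ?imV0; apply: zero.
    by have [] := torsion_lcs_orth (central_orth reZ) Zl.
  by have [] := torsion_lcs_orth (central_orth imZ) Zl.
move=> k0; have l1 : torsion_lcs D i x 1 = 0%VS.
  have: torsion_lcs D i x k.+1 = 0%VS.
    apply/eqP; rewrite -subv0; apply/span_subvP => _ /allpairsP [[X Y] [/= Xb Yb ->]].
    have : Y \in torsion_lcs D i x k := vbasis_mem Yb.
    rewrite k0 memv0 => /eqP ->.
    by rewrite (bi2_0r torsionC_bilinear) mem0v.
  by elim: k {k0} => // k IH /step.
move=> u v; have [+ _] := central 0%N (realT10 u) l1 (realT10_in u).
by move=> /(_ v); rewrite reV_complex_row.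
Qed.
End Nilpotent.
End ChartTorsion.

(** * Parallel tensors vanish on open sets *)

Lemma sum_prod_le_sum_sqr (R : realFieldType) (I : finType) (a : I -> R) :
  \sum_i \sum_j `|a i| * `|a j| <= #|I|%:R * \sum_i a i ^+ 2.
Proof.
set s := \sum_i a i ^+ 2.
have e i : \sum_(j : I) 2^-1 * (a i ^+ 2 + a j ^+ 2) = 2^-1 * (#|I|%:R * a i ^+ 2 + s).
  by rewrite -mulr_sumr big_split /= sumr_const mulr_natl.
have {}e : #|I|%:R * s = \sum_(i : I) \sum_(j : I) 2^-1 * (a i ^+ 2 + a j ^+ 2).
  rewrite (eq_bigr _ (fun i _ => e i)) -mulr_sumr big_split /= sumr_const -mulr_sumr.
  by rewrite -/s -mulr_natl; field.
rewrite e; apply: ler_sum => i _; apply: ler_sum => j _.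
rewrite -[a i ^+ 2](real_normK (num_real _)) -[a j ^+ 2](real_normK (num_real _)).
have := sqr_ge0 (`|a i| - `|a j|); rewrite sqrrB; lra.
Qed.

(** Gronwall: with phi the sum of the f_i^2 and N their number, phi' <= 2 C N phi, so
    phi exp (- 2 C N t) does not increase; it is nonnegative and starts at 0. *)
Lemma linear_ode_zero (R : realType) (I : finType) (f df : I -> R -> R) (C : R) :
  0 <= C ->
  (forall i (t : R), 0 <= t <= 1 -> is_derive (t : R^o) 1 (f i : R -> R^o) (df i t)) ->
  (forall i t, 0 <= t <= 1 -> `|df i t| <= C * \sum_j `|f j t|) ->
  (forall i, f i 0 = 0) -> forall i, f i 1 = 0.
Proof.
move=> C0 fd fle f0.
pose phi (t : R) : R^o := \sum_i f i t ^+ 2.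
pose dphi (t : R) : R^o := \sum_i 2 * (f i t * df i t).
have phid (t : R) : 0 <= t <= 1 -> is_derive (t : R^o) 1 phi (dphi t).
  move=> t01; rewrite /phi /dphi; elim: (index_enum I) => [|i r IH].
    under eq_fun do rewrite big_nil; rewrite big_nil.
    exact: is_derive_cst.
  under eq_fun do rewrite big_cons; rewrite big_cons.
  apply: is_deriveD; have fi := fd i t t01.
  by apply: is_derive_eq; rewrite /GRing.scale /=; ring.
pose c := 2 * C * #|I|%:R.
pose psi (t : R) : R^o := phi t * expR (- c * t).
pose dpsi (t : R) : R^o := (dphi t - c * phi t) * expR (- c * t).
have psid (t : R) : 0 <= t <= 1 -> is_derive (t : R^o) 1 psi (dpsi t).
  move=> t01; have pd := phid t t01; rewrite /psi /dpsi.
  have ed : is_derive (t : R^o) 1 (fun t : R^o => expR (- c * t) : R^o) (- c *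
    expR (- c * t)).
    have ld : is_derive (t : R^o) 1 (fun t : R^o => - c * t : R^o) (- c).
      by apply: is_derive_eq; rewrite /GRing.scale /=; ring.
    rewrite mulrC.
    exact: (@is_derive1_comp R expR (fun t => - c * t) t _ _ (is_derive_expR _) ld).
  by apply: is_derive_eq; rewrite /GRing.scale /=; ring.
have phi0 t : 0 <= phi t by apply: sumr_ge0 => i _; exact: sqr_ge0.
have dpsi_le0 t : 0 <= t <= 1 -> dpsi t <= 0.
  move=> t01; rewrite /dpsi pmulr_lle0 ?expR_gt0 // subr_le0.
  rewrite /dphi /c -!mulr_sumr -!mulrA; apply: ler_wpM2l => //.
  apply: le_trans (_ : C * (\sum_i \sum_j `|f i t| * `|f j t|) <= _); last first.
    by apply: ler_wpM2l => //; exact: sum_prod_le_sum_sqr.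
  rewrite mulr_sumr; apply: ler_sum => i _; apply: le_trans (ler_norm _) _.
  rewrite normrM -mulr_sumr mulrCA; apply: ler_wpM2l => //; exact: fle.
have [|||t t01] := @MVT_segment R psi dpsi 0 1.
- exact: ler01.
- by move=> t /subset_itv_oo_cc; rewrite in_itv /= => /psid.
- apply: derivable_within_continuous => t; rewrite in_itv /= => /psid.
  by move=> /@ex_derive.
rewrite subr0 mulr1 => psiE; move: t01; rewrite in_itv /= => /dpsi_le0.
rewrite -psiE /psi {2}/phi; under eq_bigr do rewrite f0 expr0n /=.
rewrite big1 // mul0r subr0 pmulr_lle0 ?expR_gt0 // => phi1.
have {}phi1 : phi 1 = 0 by apply/eqP; rewrite eq_le phi1 phi0.
move=> i; apply/eqP; rewrite -sqrf_eq0; apply/eqP.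
by move/eqP: phi1; rewrite psumr_eq0 => [/allP/(_ i (mem_index_enum i))/eqP|j _];
  rewrite ?sqr_ge0.
Qed.

Section ParallelZero.
Variables (R : realType) (m : nat).
Local Notation V := 'rV[R]_m.
Variables (U : set V) (G E : V -> V -> V -> V).
Hypothesis Uo : open U.
Hypotheses (Gt : tensor_field U G) (Et : tensor_field U E) (P : parallel U G E).
Local Notation e_ a := (delta_mx 0 a : V).

Lemma row_entry_le_norm (w : V) d : `|w 0 d| <= `|w|.
Proof. by rewrite [leRHS]/Num.Def.normr/= mx_normrE; exact: (le_bigmax _ _ (0, d)). Qed.

Lemma symbols_bounded_near x : U x ->
  exists2 C, 0 <= C & \forall y \near x, forall a b c, `|G y (e_ a) (e_ b) 0 c| <= C.
Proof.
move=> Ux; pose F y (i : 'I_m * 'I_m * 'I_m) := `|G y (e_ i.1.1) (e_ i.1.2) 0 i.2|.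
have F0 y i : 0 <= F y i by exact: normr_ge0.
exists (\sum_i F x i + 1); first by apply: addr_ge0 => //; exact: sumr_ge0.
have near_i i : \forall y \near x, F y i <= \sum_i F x i + 1.
  have fc : {for x, continuous (fun y => G y (e_ i.1.1) (e_ i.1.2) 0 i.2 : R^o)}.
    by apply/differentiable_continuous/differentiable_rowE/Gt.2.
  have /cvgr_norm_le := fc; apply.
  rewrite (bigD1 i) //= -addrA ltrDl; apply: ltr_wpDl => //; exact: sumr_ge0.
have /filter_forall : forall i, \forall y \near x, F y i <= \sum_i F x i + 1 := near_i.
by apply: filterS => y Fy a b c; exact: (Fy (a, b, c)).
Qed.

Lemma linear_entry_le (L : V -> V) (p : V) c B S : linear L ->
  (forall d, `|p 0 d| <= B) -> (forall d, `|L (e_ d) 0 c| <= S) ->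
  `|L p 0 c| <= m%:R * (B * S).
Proof.
move=> Ll pB LS; rewrite (linear_sum_delta p Ll) summxE.
apply: le_trans (ler_norm_sum _ _ _) _.
rewrite -[m in leRHS]card_ord mulr_natl -sumr_const; apply: ler_sum => d _.
by rewrite mxE normrM; apply: ler_pM.
Qed.

(** Along the segment from x to a nearby point, the components of a parallel tensor
    solve a linear system whose coefficients, contractions of the Christoffel symbols
    with the direction, are bounded. *)
Lemma parallel_zero_near x : U x -> (forall u v, E x u v = 0) ->
  \forall y \near x, forall u v, E y u v = 0.
Proof.
move=> Ux E0; have [C0 C00 GC0] := symbols_bounded_near Ux.
have [r /= r0 rP] := (nbhs_ballP _ _).1 (filterI (open_nbhs_nbhs (conj Uo Ux)) GC0).
apply/nbhs_ballP; exists r => //= y; rewrite -ball_normE /= => xy.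
pose w := y - x; have wr : `|w| <= r by rewrite /w distrC ltW.
have seg (t : R) : 0 <= t <= 1 ->
    U (x + t *: w) /\ forall a b c, `|G (x + t *: w) (e_ a) (e_ b) 0 c| <= C0.
  move=> /andP [t0 t1]; apply: rP; rewrite -ball_normE /= opprD addNKr normrN normrZ.
  rewrite ger0_norm //; apply: le_lt_trans (ler_piMl _ t1) _ => //.
  by rewrite /w distrC.
pose f (i : 'I_m * 'I_m * 'I_m) (t : R) := E (x + t *: w) (e_ i.1.1) (e_ i.1.2) 0 i.2.
pose df (i : 'I_m * 'I_m * 'I_m) (t : R) :=
  'D_w (fun y => E y (e_ i.1.1) (e_ i.1.2) 0 i.2 : R^o) (x + t *: w).
pose C1 := m%:R * (r * C0).
have C10 : 0 <= C1 by rewrite /C1 !mulr_ge0 // ltW.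
have fd i (t : R) : 0 <= t <= 1 -> is_derive (t : R^o) 1 (f i : R -> R^o) (df i t).
  move=> /seg [Ut _]; apply: is_derive_line; apply: differentiable_rowE; exact: Et.2.
have dfle i t : 0 <= t <= 1 -> `|df i t| <= (3 * (m%:R * C1)) * \sum_j `|f j t|.
  move=> /seg [Ut GC]; case: i => [[a b] c]; rewrite /df /=.
  rewrite -derive_rowE; last exact: Et.2.
  rewrite P // !mxE; set z := x + t *: w.
  have Gw d k : `|G z w (e_ d) 0 k| <= C1.
    apply: (linear_entry_le (L := fun p => G z p (e_ d))) => [|l|l].
    - exact: (Gt.1 z).1.
    - exact: le_trans (row_entry_le_norm _ _) wr.
    - exact: GC.
  set S := \sum_j _.
  have ES a' b' c' : `|E z (e_ a') (e_ b') 0 c'| <= S.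
    rewrite /S (bigD1 (a', b', c')) //= lerDl; exact: sumr_ge0.
  have t1 : `|E z (G z w (e_ a)) (e_ b) 0 c| <= m%:R * (C1 * S).
    by apply: (linear_entry_le (L := fun p => E z p (e_ b))) => //;
       exact: (Et.1 z).1.
  have t2 : `|E z (e_ a) (G z w (e_ b)) 0 c| <= m%:R * (C1 * S).
    by apply: (linear_entry_le (L := E z (e_ a))) => //; exact: (Et.1 z).2.
  have t3 : `|G z w (E z (e_ a) (e_ b)) 0 c| <= m%:R * (S * C1).
    by apply: (linear_entry_le (L := G z w)) => //; exact: (Gt.1 z).2.
  apply: le_trans (ler_normB _ _) _.
  apply: le_trans (lerD (le_trans (ler_normD _ _) (lerD t1 t2)) t3) _.
  by rewrite [S * C1]mulrC mulrA -!mulrDl ler_wpM2r ?sumr_ge0 //; lra.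
have f1 i : f i 1 = 0.
  apply: (linear_ode_zero (C := 3 * (m%:R * C1)) _ fd dfle) => [|j].
    by apply: mulr_ge0 => //; exact: mulr_ge0.
  by rewrite /f scale0r addr0 E0 mxE.
have yE : x + 1 *: w = y by rewrite scale1r /w addrC subrK.
move=> u v; rewrite (bilinear_sum_delta u v (Et.1 y)).
apply: big1 => a _; apply: big1 => b _.
have -> : E y (e_ a) (e_ b) = 0.
  by apply/rowP => c; have := f1 (a, b, c); rewrite /f yE mxE.
by rewrite scaler0.
Qed.
End ParallelZero.

(** * Vanishing of the torsion on a connected component *)

Section Transition.
Variables (R : realType) (n : nat) (M : complexManifold R n).
Variables (g : hermitianMetric M) (D : connection M).
Local Notation V := 'rV[R]_(n + n).
Implicit Types (i j : chart_index M).

Lemma chart_range_in i q : dom M i q -> chart_range i (chart M i q).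
Proof. by exists q. Qed.

Lemma overlap_range i j x : overlap i j x -> chart_range i x.
Proof. by move=> [q [iq jq] <-]; exists q. Qed.

Lemma overlap_open i j : open (overlap i j).
Proof.
rewrite openE => u [q [iq jq] qu].
have iu : chart_range i u by exists q.
have pu : param M i u = q by rewrite -qu chartK.
have jn : \forall v \near u, dom M j (param M i v).
  apply: (param_continuous iu); rewrite pu.
  by apply: open_nbhs_nbhs; split => //; exact: dom_open.
have in_ : \forall v \near u, chart_range i v.
  by apply: open_nbhs_nbhs; split => //; exact: chart_open.
apply: filterS (filterI jn in_) => v [jv [q' iq' q'v]].
by exists q' => //; split=> //; move: jv; rewrite -q'v chartK.
Qed.

Lemma transition_differentiable i j x : overlap i j x ->
  differentiable (transition i j) x.
Proof. exact: smooth_differentiable (transition_smooth i j). Qed.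

Lemma derive_transitionE i j x v : overlap i j x ->
  v *m jacobian (transition i j) x = 'D_v (transition i j) x.
Proof. by move=> Ox; rewrite deriveEjacobian //; exact: transition_differentiable. Qed.

Lemma derive_transition_differentiable i j x v : overlap i j x ->
  differentiable ('D_v (transition i j)) x.
Proof.
move=> Ox.
apply: (differentiable_eq_on (@overlap_open i j)
  (h := fun y => \sum_a v 0 a *: 'D_(delta_mx 0 a) (transition i j) y) _ Ox).
  move=> y Oy; apply: (linear_sum_delta (f := fun w => 'D_w (transition i j) y)).
  exact/derive_linear/transition_differentiable.
have -> : (fun y => \sum_a v 0 a *: 'D_(delta_mx 0 a) (transition i j) y) =
  \sum_a (v 0 a *: 'D_(delta_mx 0 a) (transition i j)).
  by apply/funext => y; rewrite fct_sumE.
apply: differentiable_sum => a; apply: differentiableZ.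
by have [_ /(_ a) [+ _]] := transition_smooth i j 2%N; apply.
Qed.

(** The inhomogeneous term of the transformation law of Christoffel symbols is a second
    derivative of the transition map, hence symmetric. *)
Lemma tors_transition i j x u v : overlap i j x ->
  tors (christ (D i)) x u v *m jacobian (transition i j) x =
  tors (christ (D j)) (transition i j x) (u *m jacobian (transition i j) x)
    (v *m jacobian (transition i j) x).
Proof.
move=> Ox; rewrite /tors mulmxBl !(symbols_transition D Ox).
have e a b : 'D_a (fun y => b *m jacobian (transition i j) y) x =
    'D_a ('D_b (transition i j)) x.
  by apply: (derive_eq_on (@overlap_open i j) _ _ Ox) => y Oy; exact:
    derive_transitionE.
have c : 'D_u ('D_v (transition i j)) x = 'D_v ('D_u (transition i j)) x.
  apply: (derive_comm_row (@overlap_open i j) _ _ _ _ Ox) => [y|y w].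
    exact: transition_differentiable.
  exact: derive_transition_differentiable.
by rewrite (e u v) (e v u) c opprD addrACA subrr add0r.
Qed.

(** The transition map is an isometry, so its differential has no kernel. *)
Lemma jacobian_transition_inj i j x (w : V) : overlap i j x ->
  w *m jacobian (transition i j) x = 0 -> w = 0.
Proof.
move=> Ox w0; apply/eqP; apply: contraT => /(gram_pos g (overlap_range Ox)).
by rewrite (gram_transition g Ox) !mulmxA w0 !mul0mx mxE ltxx.
Qed.

Definition torsion_vanishes i (q : M) :=
  forall u v, tors (christ (D i)) (chart M i q) u v = 0.

Lemma torsion_vanishes_chart i j q : dom M i q -> dom M j q ->
  torsion_vanishes j q -> torsion_vanishes i q.
Proof.
move=> iq jq T0 u v; have Ox : overlap i j (chart M i q) by exists q.
apply: (jacobian_transition_inj Ox); rewrite tors_transition //.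
by rewrite {1}/transition /= chartK // T0.
Qed.

Hypothesis D_parallel : parallel_torsion D.

(** The set where the torsion vanishes is open because the torsion is parallel, and
    closed by continuity. *)
Lemma torsion_vanishes_component p : (forall i, dom M i p -> torsion_vanishes i p) ->
  forall q, connected_component [set: M] p q ->
  forall i, dom M i q -> torsion_vanishes i q.
Proof.
move=> Tp.
pose Z : set M := [set q | exists2 i, dom M i q & torsion_vanishes i q].
have Zo : open Z.
  rewrite openE => q [i iq Tq].
  have Ux := chart_range_in iq.
  have T_tensor := tors_tensor (connection_tensor_field i D).
  have near0 := parallel_zero_near (@chart_open _ _ M i) (connection_tensor_field i D)
    T_tensor (parallel_torsion_christ (i := i) D_parallel) Ux Tq.
  have near1 : \forall q' \near q, torsion_vanishes i q'.
    exact: (chart_continuous iq) near0.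
  have near2 : \forall q' \near q, dom M i q'.
    by apply: open_nbhs_nbhs; split => //; exact: dom_open.
  by apply: filterS (filterI near1 near2) => q' [? ?]; exists i.
have Zc : closed Z.
  rewrite -[Z]setCK; apply: open_closedC; rewrite openE => q Zq.
  have [i iq] := dom_cover q.
  have [u [v Tuv]] : exists u v, tors (christ (D i)) (chart M i q) u v <> 0.
    apply: contrapT => none; apply: Zq; exists i => // u v.
    by apply: contrapT => Tuv; apply: none; exists u, v.
  have Ux := chart_range_in iq.
  have Tc : {for chart M i q, continuous (fun y => tors (christ (D i)) y u v)}.
    apply: differentiable_continuous.
    exact: (tors_tensor (connection_tensor_field i D)).2.
  have nz : nbhs (tors (christ (D i)) (chart M i q) u v) (~` [set 0 : V]).
    by apply: open_nbhs_nbhs; split => //; apply: closed_openC;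
      exact/accessible_closed_set1/hausdorff_accessible/norm_hausdorff.
  have nz_chart : \forall y \near chart M i q, tors (christ (D i)) y u v <> 0.
    exact: Tc nz.
  have near0 : \forall q' \near q, tors (christ (D i)) (chart M i q') u v <> 0.
    exact: (chart_continuous iq) nz_chart.
  have near2 : \forall q' \near q, dom M i q'.
    by apply: open_nbhs_nbhs; split => //; exact: dom_open.
  apply: filterS (filterI near0 near2) => q' [/= T' iq'] [j jq' Tj].
  by apply: T'; exact: (torsion_vanishes_chart iq' jq' Tj).
have pZ : Z p by have [i ip] := dom_cover p; exists i => //; exact: Tp.
have eA : connected_component [set: M] p `&` Z = connected_component [set: M] p.
  apply: (@component_connected _ [set: M] p).
  - by exists p; split=> //; exact: connected_component_refl.
  - by exists Z.
  - by exists Z.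
move=> q; rewrite -eA => -[_ [j jq Tq]] i iq.
exact: (torsion_vanishes_chart iq jq Tq).
Qed.
End Transition.

(** * Curvature, the Kaehler form and the conclusion *)

Section Sectional.
Variables (R : realType) (n : nat) (M : complexManifold R n).
Variables (g : hermitianMetric M) (D : connection M).
Variables (i : chart_index M) (x : 'rV[R]_(n + n)).
Local Notation V := 'rV[R]_(n + n).
Local Notation VC := 'rV[R[i]]_(n + n).
Local Notation J := (Jmx R n).
Local Notation K := (curv (christ (D i)) x).
Hypothesis Ux : chart_range i x.

Let Kb w : bilinear2 (fun u v => K u v w).
Proof. exact: (curv_bilinear (connection_tensor_field i D) w Ux). Qed.
Let Kl u v : linear (K u v).
Proof. exact: (curv_lin (connection_tensor_field i D) u v Ux). Qed.

Lemma curvatureCE X Y Z : curvatureC D i x X Y Z = complexify3 K X Y Z.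
Proof.
apply: eq_bigr => a _; apply: eq_bigr => b _; apply: eq_bigr => c _.
by rewrite curvature_atE.
Qed.

Lemma re_metricC X Y : complex.Re (metricC g i x X Y) =
  met g i x (reV X) (reV Y) - met g i x (imV X) (imV Y).
Proof. exact: re_form_real. Qed.

Let K0 u w : K u u w = 0.
Proof.
have := curvC (christ (D i)) x u u w => /eqP; rewrite -subr_eq0 opprK => /eqP e.
by rewrite -[LHS]halfvD e scaler0.
Qed.

Let JJ (a : V) : a *m J *m J = - a.
Proof. by rewrite -mulmxA Jmx_sqr mulmxN mulmx1. Qed.

Hypothesis DJ : complex_connection D.
Hypothesis H0 : forall X, X \in @T10 R n -> X != 0 -> hol_sect_curvature g D i x X = 0.

(** For X = u - i Ju one finds Re R(X, conj X, X, conj X) = - 4 R(u, Ju, u, Ju). *)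
Lemma real_sectional_eq0 u : met g i x (K u (u *m J) u) (u *m J) = 0.
Proof.
have mb := met_bilinear g i x.
have Kn a b c : K a b (- c) = - K a b c.
  by exact: (linear_fun_opp (Kl a b)).
have [->|u0] := eqVneq u 0; first by rewrite mul0mx (bi2_0r mb).
set X := realT10 u.
have X0 : X != 0.
  apply: contra_neq u0 => X0; by rewrite -[u](reV_complex_row u (- (u *m J)))
    -/(realT10 u) -/X X0 reV0.
have m0 : metricC g i x X (conjv X) != 0.
  apply: contraTneq (met_gt0 g Ux u0) => m0.
  have := re_metricC X (conjv X); rewrite m0 reV_conj imV_conj reV_complex_row
    imV_complex_row opprK.
  rewrite (bi2Nl mb) opprK metJ //= -leNgt; lra.
have := H0 (realT10_in u) X0; rewrite /hol_sect_curvature => /eqP.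
rewrite mulf_eq0 invr_eq0 expf_eq0 (negPf m0) andbF orbF => /eqP /(congr1
  (@complex.Re R)).
rewrite /curvature4 re_metricC curvatureCE reV_complexify3 // imV_complexify3 //.
rewrite reV_conj imV_conj !reV_complex_row !imV_complex_row opprK.
have KJ a b c : K a b (c *m J) = K a b c *m J.
  apply: (curv_mulmxr (@chart_open _ _ M i) (connection_tensor_field i D) _ _ _ Ux).
  by move=> *; exact: complex_connection_christ.
rewrite !(bi2Nl (Kb _)) !Kn !K0 !opprK !oppr0 .
have e1 w : K (u *m J) u w = - K u (u *m J) w by exact: curvC.
rewrite !e1 !KJ; move: (K u (u *m J) u) => k.
rewrite addr0 !add0r opprD !opprK !(bi2Dl mb).
have -> : met g i x (k *m J) u = - met g i x k (u *m J).
  exact: (J_skew (J := fun w => w *m J) mb JJ (fun a b => metJ g a b Ux)).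
move=> /=; lra.
Qed.
End Sectional.

Section Kaehler.
Variables (R : realType) (n : nat) (M : complexManifold R n).
Variables (g : hermitianMetric M) (D : connection M).
Variables (i : chart_index M) (x : 'rV[R]_(n + n)).
Local Notation J := (Jmx R n).
Hypothesis Ux : chart_range i x.

(** The Kaehler form is parallel and the symbols are symmetric in their arguments, so
    the terms of d omega cancel in pairs. *)
Lemma kahler_form_closed : hermitian_connection g D ->
  (forall u v, tors (christ (D i)) x u v = 0) ->
  forall v, ext_d (kahler_form g i) x v = 0.
Proof.
move=> [gD cD] T0 v.
have mb := met_bilinear g i x.
have GC a b : christ (D i) x a b = christ (D i) x b a.
  by have /eqP := T0 a b; rewrite /tors subr_eq0 => /eqP.
have GJ a b : christ (D i) x a (b *m J) = christ (D i) x a b *m J.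
  exact: complex_connection_christ.
have JJ (a : 'rV[R]_(n + n)) : a *m J *m J = - a.
  by rewrite -mulmxA Jmx_sqr mulmxN mulmx1.
have mJ a b : met g i x (a *m J) b = - met g i x (b *m J) a.
  rewrite (J_skew (J := fun w => w *m J) mb JJ (fun a b => metJ g a b Ux)).
  by rewrite [in RHS]metC.
have Dw a b c : 'D_a (fun y => met g i y (b *m J) c) x =
    met g i x (christ (D i) x a b *m J) c + met g i x (b *m J) (christ (D i) x a c).
  by rewrite (metric_connection_christ gD) // GJ.
rewrite /ext_d /kahler_form !big_ord_recl big_ord0 addr0.
rewrite (Dw (v ord0) (v (lift ord0 0)) (v (lift ord0 1))).
rewrite (Dw (v (lift ord0 ord0)) (v (lift (lift ord0 ord0) 0))
  (v (lift (lift ord0 ord0) 1))).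
rewrite (Dw (v (lift ord0 (lift ord0 ord0))) (v (lift (lift ord0 (lift ord0 ord0)) 0))
  (v (lift (lift ord0 (lift ord0 ord0)) 1))).
have -> : lift (lift ord0 ord0) 0 = ord0 :> 'I_3 by apply/val_inj.
have -> : lift (lift ord0 (lift ord0 ord0)) 0 = ord0 :> 'I_3 by apply/val_inj.
have -> : lift ord0 0 = lift ord0 ord0 :> 'I_3 by apply/val_inj.
have -> : lift (lift ord0 (lift ord0 ord0)) 1 = lift ord0 ord0 :> 'I_3.
  by apply/val_inj.
have -> : lift (lift ord0 ord0) 1 = lift ord0 (lift ord0 ord0) :> 'I_3.
  by apply/val_inj.
have -> : lift ord0 1 = lift ord0 (lift ord0 ord0) :> 'I_3 by apply/val_inj.
move: (v ord0) (v (lift ord0 ord0)) (v (lift ord0 (lift ord0 ord0))) => a b c.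
rewrite /= /bump /= expr0 expr1 expr2 mulrNN mulr1 !mul1r mulN1r.
rewrite [christ _ _ b a]GC [christ _ _ c a]GC [christ _ _ c b]GC.
by rewrite [met g i x (b *m J) _]mJ; ring.
Qed.
End Kaehler.

Section Main.
Variables (R : realType) (n : nat) (M : complexManifold R n).
Variables (g : hermitianMetric M) (Dc Db D0 : connection M).
Local Notation V := 'rV[R]_(n + n).
Local Notation J := (Jmx R n).
Hypotheses (hDc : chern_connection g Dc) (hDb : bismut_connection g Db)
  (hD0 : levi_civita_connection g D0).
Hypotheses (hBTP : parallel_torsion Db) (hH : zero_hol_sect_curvature g Dc).

Section Chart.
Variable i : chart_index M.
Local Notation U := (chart_range i).
Local Notation Gb := (christ (Db i)).
Local Notation Gc := (christ (Dc i)).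
Local Notation G0 := (christ (D0 i)).

Let Uo : open U. Proof. exact: chart_open. Qed.
Let hb y : @bilinear2 R V R^o (met g i y). Proof. exact: met_bilinear. Qed.
Let hd y u v : U y -> differentiable (fun y => met g i y u v) y.
Proof. exact: met_differentiable. Qed.
Let hC y u v : U y -> met g i y u v = met g i y v u. Proof. exact: metC. Qed.
Let h_gt0 y u : U y -> u != 0 -> 0 < met g i y u u. Proof. exact: met_gt0. Qed.
Let hJ y u v : U y -> met g i y (u *m J) (v *m J) = met g i y u v.
Proof. exact: metJ. Qed.
Let Gbt : tensor_field U Gb. Proof. exact: connection_tensor_field. Qed.
Let h_Gb y a u v : U y ->
  'D_a (fun y => met g i y u v) y = met g i y (Gb y a u) v + met g i y u (Gb y a v).
Proof. exact: metric_connection_christ hDb.1.1 _ _ _ _. Qed.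
Let h_Gc y a u v : U y ->
  'D_a (fun y => met g i y u v) y = met g i y (Gc y a u) v + met g i y u (Gc y a v).
Proof. exact: metric_connection_christ hDc.1.1 _ _ _ _. Qed.
Let h_G0 y a u v : U y ->
  'D_a (fun y => met g i y u v) y = met g i y (G0 y a u) v + met g i y u (G0 y a v).
Proof. exact: metric_connection_christ hD0.1 _ _ _ _. Qed.
Let GbJ y u v : U y -> Gb y u (v *m J) = Gb y u v *m J.
Proof. exact: complex_connection_christ hDb.1.2 _ _ _. Qed.
Let GcJ y u v : U y -> Gc y u (v *m J) = Gc y u v *m J.
Proof. exact: complex_connection_christ hDc.1.2 _ _ _. Qed.
Let T_parallel : parallel U Gb (tors Gb).
Proof. exact: parallel_torsion_christ hBTP. Qed.
Let hT y u v w : U y -> met g i y (tors Gb y u v) w = - met g i y (tors Gb y u w) v.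
Proof.
by move=> Uy; have [_] := hDb.2 i y Uy u v w; rewrite !torsion_atE.
Qed.
Let GcT y u v : U y -> tors Gc y (u *m J) v = tors Gc y u v *m J.
Proof.
move=> Uy; apply: (chern_torsionJ _ (fun a b => GcJ a b Uy)) => X Y.
exact: hDc.2.
Qed.
Let G0T y u v : U y -> tors G0 y u v = 0.
Proof. by move=> Uy; rewrite -torsion_atE; apply: hD0.2. Qed.
Let Hc x : U x -> forall u, met g i x (curv Gc x u (u *m J) u) (u *m J) = 0.
Proof.
by move=> Ux u; apply: real_sectional_eq0 hDc.1.2 (fun X => hH Ux (X := X)) _.
Qed.

Lemma chern_center_bismut x z : U x -> (forall v, tors Gc x z v = 0) ->
  forall u, tors Gb x u z = 0.
Proof.
move=> Ux.
exact: (torsion_central_eq0 Uo (Jmx_sqr R n) hb hd hC h_gt0 hJ Gbt h_Gb h_Gc GbJ GcJ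
  hT T_parallel GcT Ux (Hc Ux)).
Qed.

Lemma chern_tors_bismut x u v : U x ->
  tors Gc x u v = chernTors (fun w => w *m J) (tors Gb x) u v.
Proof.
move=> Ux; exact: (chern_tors (Jmx_sqr R n) hb hC h_gt0 hJ Gbt h_Gb h_Gc GbJ
  GcJ hT GcT).
Qed.

Lemma bismut_tors0_flat x : U x -> (forall u v, tors Gb x u v = 0) ->
  forall u v w, curv Gc x u v w = 0 /\ curv G0 x u v w = 0.
Proof.
move=> Ux T0 u v w.
by have [] := torsion_eq0_flat Uo (Jmx_sqr R n) hb hd hC h_gt0 hJ Gbt h_Gb h_Gc h_G0
  GbJ GcJ hT T_parallel GcT G0T Ux (Hc Ux) T0 u v w.
Qed.

(** The Chern torsion is 1/2 J (T(u, Jv) + T(Ju, v)), so its product with a central z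
    only involves T(., Jz), which vanishes as Jz is central too. *)
Lemma nilpotent_bismut_tors0 x k : U x -> torsion_lcs Dc i x k = 0%VS ->
  forall u v, tors Gb x u v = 0.
Proof.
move=> Ux k0.
have tC (G : V -> V -> V -> V) a b : tors G x a b = - tors G x b a.
  by rewrite /tors opprB.
have tJ u v : tors Gc x (u *m J) v = tors Gc x u v *m J by exact: GcT.
have orth z : (forall v, tors Gc x z v = 0) -> forall u v, met g i x (tors Gc x
  u v) z = 0.
  move=> z0 u v.
  have zJ0 w : tors Gc x (z *m J) w = 0 by rewrite tJ z0 mul0mx.
  have bz w w' : met g i x (tors Gb x w w') (z *m J) = 0.
    by rewrite hT // (chern_center_bismut Ux zJ0) (bi2_0l (hb x)) oppr0.
  rewrite chern_tors_bismut // /chernTors (bi2Zl (hb x)) mulmxDl (bi2Dl (hb x)).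
  have gJ w : met g i x (w *m J) z = - met g i x w (z *m J).
    apply: (J_skew (J := fun w => w *m J) (hb x) _ (fun a b => hJ a b Ux)) => a.
    by rewrite -mulmxA Jmx_sqr mulmxN mulmx1.
  by rewrite !gJ !bz oppr0 addr0 scaler0.
have c0 := nilpotent_torsion_eq0 (hb x) (fun u => @h_gt0 x u Ux) tJ orth k0.
by move=> u v; apply: (chern_center_bismut Ux) => w; exact: c0.
Qed.
End Chart.

Lemma nilpotent_torsion_component (p : M) : torsion_nilpotent Dc p ->
  [/\ torsion_free_on Dc (connected_component [set: M] p),
      flat_on Dc (connected_component [set: M] p),
      kahler_on g (connected_component [set: M] p) &
      flat_on D0 (connected_component [set: M] p)].
Proof.
move=> hp.
have Tp i : dom M i p -> torsion_vanishes Db i p.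
  move=> ip; have [k k0] := hp i ip.
  by move=> u v; exact: (nilpotent_bismut_tors0 (chart_range_in ip) k0).
have T0 := torsion_vanishes_component g hBTP Tp.
split=> q pq i iq.
- move=> X Y _ _; have Ux := chart_range_in iq.
  rewrite torsionCE // /complexify2 big1 // => a _; rewrite big1 // => b _.
  rewrite chern_tors_bismut // /chernTors !(T0 q pq i iq) addr0 mul0mx scaler0.
  by rewrite map_mx0 scaler0.
- move=> u v w; rewrite curvature_atE.
  by have [] := bismut_tors0_flat (chart_range_in iq) (T0 q pq i iq) u v w.
- exact: (kahler_form_closed (chart_range_in iq) hDb.1 (T0 q pq i iq)).
move=> u v w; rewrite curvature_atE.
by have [] := bismut_tors0_flat (chart_range_in iq) (T0 q pq i iq) u v w.
Qed.
End Main.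

Theorem corollary7p4 (R : realType) (n : nat) (hn : (2 <= n)%N)
  (M : complexManifold R n) (g : hermitianMetric M)
  (Dc Db D0 : connection M)
  (hDc : chern_connection g Dc) (hDb : bismut_connection g Db)
  (hD0 : levi_civita_connection g D0)
  (hbal : balanced g) (hBTP : parallel_torsion Db)
  (hH : zero_hol_sect_curvature g Dc)
  (p : M) (hp : torsion_nilpotent Dc p) :
  [/\ torsion_free_on Dc (connected_component [set: M] p),
      flat_on Dc (connected_component [set: M] p),
      kahler_on g (connected_component [set: M] p) &
      flat_on D0 (connected_component [set: M] p)].
Proof. exact: nilpotent_torsion_component hDc hDb hD0 hBTP hH p hp. Qed.
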